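(* Let $R=\mathbb{C}[x_1,x_2,x_3,x_4]_{(x_1,x_2,x_3,x_4)}$. There exists a divisorial valuation $v$ of the field $\mathbb{C}(x_1,x_2,x_3,x_4)$ centered in $R$ whose associated graded ring $$\mathrm{gr}_v R=\bigoplus_{m\ge 0}\mathfrak{q}_m/\mathfrak{q}_m^{+}$$ is not finitely generated.
   Context: A rank one valuation $v$ of $K=\mathbb{C}(x_1,\dots,x_4)$ (trivial on $\mathbb{C}$) is centered in the local ring $(R,\mathfrak{m})$ if $v$ is nonnegative on $R$ and strictly positive on $\mathfrak{m}$. A divisorial valuation is a rank one valuation whose residue field has transcendence degree $n-1=3$ over $\mathbb{C}$ (equivalently, the valuation attached to an irreducible exceptional divisor of a birational map); it is taken with value group $\mathbb{Z}$. For an integer $m\ge 0$ put $\mathfrak{q}_m=\{g\in R: v(g)\ge m\}$ and $\mathfrak{q}_m^{+}=\{g\in R: v(g)>m\}$. Finitely generated means finitely generated as a $\mathbb{C}$-algebra, where $\mathbb{C}=\mathfrak{q}_0/\mathfrak{q}_0^{+}$. *)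

(* Defs.v *)
From HB Require Import structures.
From mathcomp Require Import all_boot all_order all_algebra.
From mathcomp Require Import generic_quotient ring_quotient.
From mathcomp Require Import boolp reals.
From mathcomp Require Import complex mpoly.

Set Implicit Arguments.
Unset Strict Implicit.
Unset Printing Implicit Defensive.

Import Order.TTheory GRing.Theory Num.Theory.
Local Open Scope ring_scope.
Local Open Scope quotient_scope.

Section Algebras.

(* A k-algebra A is given by its structure morphism f. *)
Variables (k A : comNzRingType) (f : {rmorphism k -> A}).

Definition finitely_generated_algebra : Prop :=
  exists (r : nat) (g : 'I_r -> A),
    forall a : A, exists P : {mpoly k[r]}, a = mmap f g P.

Definition algebraically_independent (d : nat) (u : 'I_d -> A) : Prop :=
  forall P : {mpoly k[d]}, mmap f u P = 0 -> P = 0.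

Definition transcendence_degree_is (d : nat) : Prop :=
  (exists u : 'I_d -> A, algebraically_independent u) /\
  (forall u : 'I_d.+1 -> A, ~ algebraically_independent u).

End Algebras.

Section Valuations.

Variables (k K : fieldType) (iota : {rmorphism k -> K}).

(* The value of 0 is +oo by convention: [vfun 0] is an irrelevant integer, and
   every use of [vfun] below treats 0 separately. *)
Record valuation := Valuation {
  vfun :> K -> int;
  vfunM : forall x y, x != 0 -> y != 0 -> vfun (x * y) = vfun x + vfun y;
  vfunD : forall x y, x != 0 -> y != 0 -> x + y != 0 ->
    Num.min (vfun x) (vfun y) <= vfun (x + y);
  vfun_trivial : forall c, c != 0 -> vfun (iota c) = 0;
  vfun_onto : forall m : int, exists2 x, x != 0 & vfun x = m
}.

Variable v : valuation.

Definition vge (m : int) : {pred K} := fun x => (x == 0) || (m <= v x).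
Definition vgt (m : int) : {pred K} := fun x => (x == 0) || (m < v x).

Lemma vgt_vge m x : (x \in vgt m) = (x \in vge (m + 1)).
Proof. by rewrite !unfold_in lezD1. Qed.

Lemma vge_zmod m : zmod_closed (vge m).
Proof.
have v1 : v 1 = 0 by rewrite -(rmorph1 iota) vfun_trivial ?oner_eq0.
have vN1 : v (-1) = 0.
  by rewrite -(rmorphN1 iota) vfun_trivial // oppr_eq0 oner_eq0.
split=> [|x y]; first by rewrite unfold_in eqxx.
rewrite !unfold_in => hx hy.
have [//|xy0 /=] := eqVneq (x - y) 0.
have [x0|x0] := eqVneq x 0.
  rewrite x0 add0r in xy0 *; rewrite oppr_eq0 in xy0.
  by rewrite -mulN1r vfunM ?oppr_eq0 ?oner_eq0 // vN1 add0r; rewrite (negPf xy0) in hy.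
have [y0|y0] := eqVneq y 0; first by rewrite y0 subr0; rewrite (negPf x0) in hx.
rewrite (negPf x0) (negPf y0) /= in hx hy.
apply: le_trans (vfunD v _ _ xy0); rewrite ?oppr_eq0 // le_min hx.
by rewrite -mulN1r vfunM ?oppr_eq0 ?oner_eq0 // vN1 add0r.
Qed.

Lemma vgeM m n x y : x \in vge m -> y \in vge n -> x * y \in vge (m + n).
Proof.
rewrite !unfold_in mulf_eq0.
have [//|x0] := eqVneq x 0; have [//|y0 /=] := eqVneq y 0.
by move=> hx hy; rewrite vfunM // lerD.
Qed.

Lemma vge_iota c : iota c \in vge 0.
Proof.
rewrite unfold_in fmorph_eq0.
by have [//|c0] := eqVneq c 0; rewrite vfun_trivial.
Qed.

Lemma vge1 : 1 \in vge 0.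
Proof. by rewrite -(rmorph1 iota) vge_iota. Qed.

Lemma vgt1 : 1 \notin vgt 0.
Proof.
by rewrite unfold_in oner_eq0 -(rmorph1 iota) vfun_trivial ?oner_eq0 // ltxx.
Qed.

HB.instance Definition _ m := GRing.isZmodClosed.Build K (vge m) (vge_zmod m).

Lemma vgt_zmod m : zmod_closed (vgt m).
Proof.
by split=> [|x y]; rewrite !vgt_vge ?rpred0 // => hx hy; rewrite rpredB.
Qed.

HB.instance Definition _ m := GRing.isZmodClosed.Build K (vgt m) (vgt_zmod m).

Definition valuation_ring_pred : {pred K} := vge 0.

Lemma valuation_ring_subring : subring_closed valuation_ring_pred.
Proof.
split=> [|x y hx hy|x y hx hy]; first exact: vge1.
  exact: rpredB.
by have := vgeM hx hy; rewrite addr0.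
Qed.

HB.instance Definition _ :=
  GRing.isSubringClosed.Build K valuation_ring_pred valuation_ring_subring.

Record valuation_ring := ValuationRing {
  vring_val :> K;
  vring_valP : vring_val \in valuation_ring_pred
}.
HB.instance Definition _ := [isSub for vring_val].
HB.instance Definition _ := [Choice of valuation_ring by <:].
HB.instance Definition _ :=
  [SubChoice_isSubComNzRing of valuation_ring by <:].

Definition valuation_ideal : {pred valuation_ring} :=
  fun x => val x \in vgt 0.

Lemma valuation_idealE x : (x \in valuation_ideal) = (val x \in vgt 0).
Proof. by []. Qed.

Lemma valuation_ideal_closed : idealr_closed valuation_ideal.
Proof.
split=> [||a x y]; rewrite !valuation_idealE.
- by rewrite rmorph0 rpred0.
- by rewrite rmorph1 vgt1.
move=> hx hy; rewrite rmorphD rmorphM rpredD // vgt_vge.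
by rewrite -[0 + 1]add0r vgeM ?(valP a) // -vgt_vge.
Qed.

HB.instance Definition _ :=
  isIdealr.Build valuation_ring valuation_ideal valuation_ideal_closed.

Definition residue_field := {ideal_quot valuation_ideal}.
HB.instance Definition _ := GRing.ComNzRing.on residue_field.

Lemma residue_field_inv (x : residue_field) : x != 0 -> exists y, x * y = 1.
Proof.
rewrite -[x]reprK; set a := repr x => x0.
have a_notin : a \notin valuation_ideal.
  apply: contraNN x0 => ha; rewrite -(rmorph0 \pi_{ideal_quot valuation_ideal}).
  by rewrite -(Quotient.idealrBE valuation_ideal) subr0.
have a0 : val a != 0.
  by apply: contraNneq a_notin => a0; rewrite valuation_idealE a0 rpred0.
have va : v (val a) = 0.
  move: a_notin (valP a); rewrite valuation_idealE !unfold_in (negPf a0) /=.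
  rewrite -leNgt => le0 ge0.
  by apply/eqP; rewrite eq_le le0.
have aV : (val a)^-1 \in valuation_ring_pred.
  rewrite unfold_in invr_eq0 (negPf a0) /=.
  have := vfunM v a0 (_ : (val a)^-1 != 0).
  rewrite invr_eq0 divff // va add0r -{1}(rmorph1 iota) => <- //.
  by rewrite vfun_trivial ?oner_eq0.
exists (\pi_{ideal_quot valuation_ideal} (ValuationRing aV)).
rewrite -rmorphM -(rmorph1 \pi_{ideal_quot valuation_ideal}).
by congr (\pi _); apply: val_inj; rewrite rmorphM rmorph1 /= divff.
Qed.

Definition residue_const (c : k) : residue_field :=
  \pi_{ideal_quot valuation_ideal} (ValuationRing (vge_iota c)).

Lemma residue_const_zmod_morphism : zmod_morphism residue_const.
Proof.
by move=> x y; rewrite -[RHS]rmorphB; congr (\pi _); apply: val_inj; rewrite /= rmorphB.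
Qed.
Lemma residue_const_monoid_morphism : monoid_morphism residue_const.
Proof.
split=> [|x y].
  by rewrite -[RHS](rmorph1 \pi_{ideal_quot valuation_ideal}); congr (\pi _);
     apply: val_inj; rewrite /= rmorph1.
by rewrite -[RHS]rmorphM; congr (\pi _); apply: val_inj; rewrite /= rmorphM.
Qed.
HB.instance Definition _ :=
  GRing.isZmodMorphism.Build k residue_field residue_const residue_const_zmod_morphism.
HB.instance Definition _ :=
  GRing.isMonoidMorphism.Build k residue_field residue_const residue_const_monoid_morphism.

Definition centered_in (R m : {pred K}) : Prop :=
  (forall x, x \in R -> x != 0 -> 0 <= v x) /\
  (forall x, x \in m -> x != 0 -> 0 < v x).

Section Graded.

Variable R : subringClosed K.

Definition value_ideal (m : nat) : {pred K} :=
  fun g => (g \in R) && (g \in vge m%:Z).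
Definition value_ideal_plus (m : nat) : {pred K} :=
  fun g => (g \in R) && (g \in vgt m%:Z).

Lemma value_idealE m g :
  (g \in value_ideal m) = (g \in R) && (g \in vge m%:Z).
Proof. by []. Qed.
Lemma value_ideal_plusE m g :
  (g \in value_ideal_plus m) = (g \in R) && (g \in vgt m%:Z).
Proof. by []. Qed.

Lemma value_ideal_zmod m : zmod_closed (value_ideal m).
Proof.
split=> [|x y]; rewrite !(value_idealE, value_ideal_plusE) ?rpred0 // => /andP[xR xv] /andP[yR yv].
by rewrite !rpredB.
Qed.
HB.instance Definition _ m :=
  GRing.isZmodClosed.Build K (value_ideal m) (value_ideal_zmod m).

Lemma value_ideal_plus_zmod m : zmod_closed (value_ideal_plus m).
Proof.
split=> [|x y]; rewrite !(value_idealE, value_ideal_plusE) ?rpred0 // => /andP[xR xv] /andP[yR yv].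
by rewrite !rpredB.
Qed.
HB.instance Definition _ m :=
  GRing.isZmodClosed.Build K (value_ideal_plus m) (value_ideal_plus_zmod m).

Lemma value_idealM m n x y :
  x \in value_ideal m -> y \in value_ideal n -> x * y \in value_ideal (m + n).
Proof.
rewrite !(value_idealE, value_ideal_plusE) => /andP[xR xv] /andP[yR yv].
by rewrite rpredM // PoszD vgeM.
Qed.

Lemma value_ideal_plusM m n x y : x \in value_ideal m ->
  y \in value_ideal_plus n -> x * y \in value_ideal_plus (m + n).
Proof.
rewrite !(value_idealE, value_ideal_plusE) => /andP[xR xv] /andP[yR].
rewrite !vgt_vge => yv.
by rewrite rpredM // andTb -addn1 PoszD PoszD -addrA vgeM.
Qed.

(* gr_v R is built as the quotient of the graded ring (+)_m q_m T^m, a subring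
   of K[T], by its homogeneous ideal (+)_m q_m^+ T^m. Its degree m component is
   q_m / q_m^+, and multiplication is induced by that of R. *)
Definition rees_pred : {pred {poly K}} :=
  fun p => [forall i : 'I_(size p), p`_i \in value_ideal i].

Lemma rees_predP (p : {poly K}) :
  reflect (forall i, p`_i \in value_ideal i) (p \in rees_pred).
Proof.
apply: (iffP forallP) => h i //; have [ip|ip] := ltnP i (size p).
  exact: h (Ordinal ip).
by rewrite nth_default // rpred0.
Qed.

Lemma value_ideal1 : 1 \in value_ideal 0.
Proof. by rewrite value_idealE rpred1 vge1. Qed.

Lemma rees_subring : subring_closed rees_pred.
Proof.
split=> [|p q /rees_predP hp /rees_predP hq|p q /rees_predP hp /rees_predP hq];
  apply/rees_predP=> i.
- by rewrite coef1; case: i => [|i]; rewrite ?value_ideal1 ?rpred0.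
- by rewrite coefB rpredB.
rewrite coefM rpred_sum // => j _.
by have := value_idealM (hp j) (hq (i - j)%N); rewrite subnKC // -ltnS.
Qed.

HB.instance Definition _ :=
  GRing.isSubringClosed.Build {poly K} rees_pred rees_subring.

Record rees := Rees {
  rees_val :> {poly K};
  rees_valP : rees_val \in rees_pred
}.
HB.instance Definition _ := [isSub for rees_val].
HB.instance Definition _ := [Choice of rees by <:].
HB.instance Definition _ := [SubChoice_isSubComNzRing of rees by <:].

Definition rees_plus : {pred rees} :=
  fun p => [forall i : 'I_(size (val p)), (val p)`_i \in value_ideal_plus i].

Lemma rees_plusP (p : rees) :
  reflect (forall i, (val p)`_i \in value_ideal_plus i) (p \in rees_plus).
Proof.
apply: (iffP forallP) => h i //; have [ip|ip] := ltnP i (size (val p)).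
  exact: h (Ordinal ip).
by rewrite nth_default // rpred0.
Qed.

Lemma rees_plus_closed : idealr_closed rees_plus.
Proof.
split=> [||a p q /rees_plusP hp /rees_plusP hq].
- by apply/rees_plusP=> i; rewrite rmorph0 coef0 rpred0.
- apply/negP=> /rees_plusP/(_ 0%N); rewrite rmorph1 coef1 value_ideal_plusE.
  by rewrite (negPf vgt1) andbF.
apply/rees_plusP=> i; rewrite rmorphD rmorphM coefD rpredD //.
rewrite coefM rpred_sum // => j _.
have := value_ideal_plusM (rees_predP _ (valP a) j) (hp (i - j)%N).
by rewrite subnKC // -ltnS.
Qed.

HB.instance Definition _ := isIdealr.Build rees rees_plus rees_plus_closed.

Definition graded_ring := {ideal_quot rees_plus}.
HB.instance Definition _ := GRing.ComNzRing.on graded_ring.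

Lemma graded_ring_eqP (p q : rees) :
  \pi_{ideal_quot rees_plus} p = \pi_{ideal_quot rees_plus} q <->
  forall m, (val p)`_m - (val q)`_m \in value_ideal_plus m.
Proof.
have -> : \pi_{ideal_quot rees_plus} p = \pi_{ideal_quot rees_plus} q <->
          p - q \in rees_plus.
  by rewrite (Quotient.idealrBE rees_plus); split=> /eqP.
split=> [/rees_plusP h m|h]; first by rewrite -coefB -rmorphB.
by apply/rees_plusP=> m; rewrite rmorphB coefB.
Qed.

Hypothesis iotaR : forall c, iota c \in R.

Lemma rees_const_proof c : (iota c)%:P \in rees_pred.
Proof.
apply/rees_predP=> i; rewrite coefC; case: i => [|i] /=; last exact: rpred0.
by rewrite value_idealE iotaR vge_iota.
Qed.

Definition graded_const (c : k) : graded_ring :=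
  \pi_{ideal_quot rees_plus} (Rees (rees_const_proof c)).

Lemma graded_const_zmod_morphism : zmod_morphism graded_const.
Proof.
by move=> x y; rewrite -[RHS]rmorphB; congr (\pi _); apply: val_inj; rewrite /= !rmorphB.
Qed.
Lemma graded_const_monoid_morphism : monoid_morphism graded_const.
Proof.
split=> [|x y].
  by rewrite -[RHS](rmorph1 \pi_{ideal_quot rees_plus}); congr (\pi _);
     apply: val_inj; rewrite /= !rmorph1.
by rewrite -[RHS]rmorphM; congr (\pi _); apply: val_inj; rewrite /= !rmorphM.
Qed.
HB.instance Definition _ :=
  GRing.isZmodMorphism.Build k graded_ring graded_const graded_const_zmod_morphism.
HB.instance Definition _ :=
  GRing.isMonoidMorphism.Build k graded_ring graded_const graded_const_monoid_morphism.

End Graded.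

End Valuations.

Section RationalFunctions.

Variables (k : fieldType) (n : nat).

Definition ratfun := {fraction {mpoly k[n]}}.
HB.instance Definition _ := GRing.Field.on ratfun.

Definition ratfun_of_poly : {rmorphism {mpoly k[n]} -> ratfun} := @tofrac _.

Definition ratfun_const : {rmorphism k -> ratfun} :=
  @tofrac {mpoly k[n]} \o @mpolyC n k.

(* k[x_1, ..., x_n] localized at (x_1, ..., x_n), as a subring of the rational
   function field: a polynomial lies in (x_1, ..., x_n) iff it vanishes at the
   origin. *)
Definition local_ring : {pred ratfun} := fun z =>
  `[< exists f g : {mpoly k[n]}, g.@[fun=> 0] != 0 /\
        z = ratfun_of_poly f / ratfun_of_poly g >].

Definition local_maximal_ideal : {pred ratfun} := fun z =>
  `[< exists f g : {mpoly k[n]}, [/\ f.@[fun=> 0] = 0, g.@[fun=> 0] != 0 &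
        z = ratfun_of_poly f / ratfun_of_poly g] >].

Lemma ratfun_of_poly_eq0 f : (ratfun_of_poly f == 0) = (f == 0).
Proof. exact: tofrac_eq0. Qed.

Lemma denominator_neq0 (g : {mpoly k[n]}) :
  g.@[fun=> 0] != 0 -> ratfun_of_poly g != 0.
Proof.
by rewrite ratfun_of_poly_eq0; apply: contraNneq => ->; rewrite meval0.
Qed.

Lemma local_ring_subring : subring_closed local_ring.
Proof.
split=> [|x y /asboolP[f [g [g0 ->]]] /asboolP[f' [g' [g'0 ->]]]
         |x y /asboolP[f [g [g0 ->]]] /asboolP[f' [g' [g'0 ->]]]]; apply/asboolP.
- by exists 1, 1; rewrite meval1 oner_eq0 rmorph1 divr1.
- exists (f * g' - f' * g), (g * g'); rewrite mevalM mulf_neq0 //; split=> //.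
  rewrite rmorphB !rmorphM /= -[- (_ / _)]mulNr addf_div ?denominator_neq0 //.
  by rewrite mulNr.
- exists (f * f'), (g * g'); rewrite mevalM mulf_neq0 //; split=> //.
  by rewrite !rmorphM /= mulf_div.
Qed.

HB.instance Definition _ :=
  GRing.isSubringClosed.Build ratfun local_ring local_ring_subring.

Lemma ratfun_const_local c : ratfun_const c \in local_ring.
Proof.
by apply/asboolP; exists c%:MP, 1; rewrite meval1 oner_eq0 rmorph1 divr1.
Qed.

(* The value group is Z by the field [vfun_onto] of [valuation]. *)
Definition divisorial (v : valuation ratfun_const) : Prop :=
  transcendence_degree_is (residue_const v) n.-1.

Definition centered_at_origin (v : valuation ratfun_const) : Prop :=
  centered_in v local_ring local_maximal_ideal.

Definition local_gr_const (v : valuation ratfun_const) :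
    {rmorphism k -> graded_ring v local_ring} :=
  graded_const v ratfun_const_local.

End RationalFunctions.

(* Main.v *)
Require Import Defs.
From mathcomp Require Import all_boot all_order all_algebra.
From mathcomp Require Import generic_quotient ring_quotient fraction.
From mathcomp Require Import reals complex mpoly boolp.
From mathcomp Require Import ring zify.

(* Write [y = Y / X], [z = Z / X] and consider the cuspidal cubic
   [z = y^2 + y^3], whose cusp is at infinity, at its non-inflection point
   [y = z = 0].  The valuation [v] is monomial in the coordinates [X], [W], [y]
   and [z - y^2 - y^3], with weights 1, 1, 1 and 9 (the self-intersection of the
   cubic).  Modulo the cubic, a form of degree [d] vanishes at the point to
   order at most [3 d], and order exactly [3 d] would make the point torsion in
   the smooth locus of the cubic, which is the additive group: impossible in
   characteristic 0.  Forms of degree [d] vanishing to order [3 d - 1], even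
   along the weighted jets defining [v], do exist, by successive corrections by
   multiples of the cubic.  So in the graded ring modulo the cubic the slopes
   (order / degree) approach but never reach 3, whereas finitely many generators
   would keep them away from 3. *)

Set Implicit Arguments.
Unset Strict Implicit.
Unset Printing Implicit Defensive.

Import Order.TTheory GRing.Theory Num.Theory.
Local Open Scope ring_scope.
Local Open Scope quotient_scope.

Local Notation o n i := (@Ordinal n i isT).

(** * Initial coefficients and lowest degrees *)

Section InitialCoefficients.

Variable S : comNzRingType.
Implicit Types (p q : {poly S}) (c d : S) (m n : nat).

(** The coefficient [c] may vanish, so that [initial m p 0] encodes order greater than [m]. One
    predicate thus serves for both [vge] and [vgt], the zero polynomial included. *)
Definition initial m p c := (forall i, (i < m)%N -> p`_i = 0) /\ p`_m = c.

Lemma initial0 m : initial m 0 0.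
Proof. by split=> [i _|]; rewrite coef0. Qed.

Lemma initialC c : initial 0 c%:P c.
Proof. by split=> //; rewrite coefC. Qed.

Lemma initialD m p q c d :
  initial m p c -> initial m q d -> initial m (p + q) (c + d).
Proof.
move=> [p0 <-] [q0 <-]; split=> [i im|]; last by rewrite coefD.
by rewrite coefD p0 ?q0 ?addr0.
Qed.

Lemma initialN m p c : initial m p c -> initial m (- p) (- c).
Proof.
move=> [p0 <-]; split=> [i im|]; last by rewrite coefN.
by rewrite coefN p0 ?oppr0.
Qed.

Lemma initialM m n p q c d :
  initial m p c -> initial n q d -> initial (m + n) (p * q) (c * d).
Proof.
move=> [p0 pm] [q0 qn]; split=> [i im|].
  rewrite coefM big1 // => -[j /= ji] _.
  have [/p0->|mj] := ltnP j m; first by rewrite mul0r.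
  by rewrite q0 ?mulr0 //; lia.
have mP : (m < (m + n).+1)%N by lia.
rewrite coefM (bigD1 (Ordinal mP)) //= addKn pm qn big1 ?addr0 // => -[j /= ji].
rewrite -val_eqE /= => jm.
have [/p0->|mj] := ltnP j m; first by rewrite mul0r.
by rewrite q0 ?mulr0 //; lia.
Qed.

Lemma initial_sum m (I : Type) (r : seq I) (P : pred I) (F : I -> {poly S})
    (G : I -> S) :
  (forall i, P i -> initial m (F i) (G i)) ->
  initial m (\sum_(i <- r | P i) F i) (\sum_(i <- r | P i) G i).
Proof.
move=> FG; elim/big_rec2: _ => [|i c p Pi IH]; first exact: initial0.
exact: initialD (FG _ Pi) IH.
Qed.

Lemma initialX m p c n : initial m p c -> initial (m * n) (p ^+ n) (c ^+ n).
Proof.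
move=> pc; elim: n => [|n IH]; first by rewrite muln0 !expr0; apply: initialC.
by rewrite mulnS !exprS; apply: initialM.
Qed.

Lemma initial_prod (I : Type) (r : seq I) (F : I -> {poly S}) (G : I -> S)
    (M : I -> nat) :
  (forall i, initial (M i) (F i) (G i)) ->
  initial (\sum_(i <- r) M i) (\prod_(i <- r) F i) (\prod_(i <- r) G i).
Proof.
move=> FG; elim: r => [|i r IH]; first by rewrite !big_nil; apply: initialC.
by rewrite !big_cons; apply: initialM.
Qed.

Lemma initial_inj m p c d : initial m p c -> initial m p d -> c = d.
Proof. by move=> [_ <-] [_ <-]. Qed.

End InitialCoefficients.

Section LowestDegree.

Variable S : idomainType.
Implicit Types (p q : {poly S}) (m : nat).

Definition lowdeg p := find (fun c => c != 0) p.

Lemma initial_lowdeg p : initial (lowdeg p) p p`_(lowdeg p).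
Proof. by split=> // i /(before_find 0)/negbFE/eqP. Qed.

Lemma lowdeg_neq0 p : p != 0 -> p`_(lowdeg p) != 0.
Proof.
move=> p0; apply: (@nth_find _ _ (fun c => c != 0)).
apply/(has_nthP 0); exists (size p).-1; last by rewrite -lead_coefE lead_coef_eq0.
by rewrite ltn_predL lt0n size_poly_eq0.
Qed.

Lemma initial_lowdegE m p c : c != 0 -> initial m p c -> lowdeg p = m.
Proof.
move=> c0 [pm pc]; have p0 : p != 0.
  by apply: contraNneq c0 => p0; rewrite -pc p0 coef0.
case: (ltngtP (lowdeg p) m) => // lt.
  by have := lowdeg_neq0 p0; rewrite pm ?eqxx.
by have [/(_ m lt)] := initial_lowdeg p; rewrite pc => c00; rewrite c00 eqxx in c0.
Qed.

Lemma initial_geq m p : p != 0 -> initial m p p`_m <-> (m <= lowdeg p)%N.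
Proof.
move=> p0; split=> [[pm _]|mp].
  by rewrite leqNgt; apply/negP => /pm/eqP; apply/negP/lowdeg_neq0.
have [pm _] := initial_lowdeg p.
by split=> // i im; apply: pm; apply: leq_trans im mp.
Qed.

Lemma initial_gt m p : p != 0 -> initial m p 0 <-> (m < lowdeg p)%N.
Proof.
move=> p0; split=> [[pm pm0]|mp].
  rewrite leqNgt; apply/negP => /[!ltnS] le.
  by move: (lowdeg_neq0 p0); move: le; rewrite leq_eqVlt => /orP[/eqP->|/pm->];
    rewrite ?pm0 eqxx.
have [pm pm0] := initial_lowdeg p.
by split=> [i im|]; apply: pm => //; apply: ltn_trans im mp.
Qed.

Lemma lowdegM p q : p != 0 -> q != 0 -> lowdeg (p * q) = (lowdeg p + lowdeg q)%N.
Proof.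
move=> p0 q0; apply: initial_lowdegE (initialM (initial_lowdeg p) (initial_lowdeg q)).
by rewrite mulf_neq0 ?lowdeg_neq0.
Qed.

Lemma lowdegC c : c != 0 -> lowdeg c%:P = 0%N.
Proof. by move=> c0; apply: initial_lowdegE c0 (initialC c). Qed.

Lemma lowdegD p q : p + q != 0 -> (minn (lowdeg p) (lowdeg q) <= lowdeg (p + q))%N.
Proof.
move=> pq0; apply/initial_geq => //; split=> // i; rewrite leq_min => /andP[ip iq].
have [ep _] := initial_lowdeg p; have [eq _] := initial_lowdeg q.
by rewrite coefD ep ?eq ?addr0.
Qed.

End LowestDegree.

(** * Fractions and common denominators *)

Section Fractions.

Variable A : idomainType.

Lemma fraction_div (z : {fraction A}) :
  exists f g : A, g != 0 /\ z = tofrac f / tofrac g.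
Proof.
elim/quotW: z => x; exists \n_x, \d_x.
have dx := denom_ratioP x; split=> //.
apply: (@mulIf _ (tofrac \d_x)); first by rewrite tofrac_eq0.
rewrite divfK ?tofrac_eq0 // !piE; apply/eqP; rewrite -[_ == _]/(_ == _ :> FracField.type A).
rewrite piE /= FracField.equivfE /FracField.mulf !numden_Ratio ?oner_eq0 ?mulr1 //.
by rewrite mulrC.
Qed.

Lemma common_denominator (I : finType) (z : I -> {fraction A}) :
  exists (f : I -> A) (g : A), g != 0 /\ forall i, z i = tofrac (f i) / tofrac g.
Proof.
have /choice[f /choice[g fg]] : forall i, exists f g : A,
  g != 0 /\ z i = tofrac f / tofrac g by move=> i; apply: fraction_div.
exists (fun i => f i * \prod_(j | j != i) g j), (\prod_j g j); split.
  by apply/prodf_neq0 => i _; have [] := fg i.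
move=> i; have [gi ->] := fg i; rewrite [X in _ = _ / tofrac X](bigD1 i) //= !tofracM.
have h0 : tofrac (\prod_(j | j != i) g j) != 0.
  by rewrite tofrac_eq0; apply/prodf_neq0 => j _; have [] := fg j.
by rewrite -mulf_div divff ?mulr1.
Qed.

End Fractions.

(** * The valuation pulled back from lowest degrees *)

Lemma ratfun_common_denominator (k : fieldType) n (I : finType) (z : I -> ratfun k n) :
  exists (f : I -> {mpoly k[n]}) (g : {mpoly k[n]}), g != 0 /\
    forall i, z i = ratfun_of_poly k n (f i) / ratfun_of_poly k n g.
Proof. exact: (@common_denominator {mpoly k[n]} I z). Qed.

Section PullbackValuation.

Variables (k : fieldType) (n : nat) (S : idomainType).
Variables (theta : {rmorphism k -> S}).
Variables (phi : {rmorphism {mpoly k[n]} -> {poly S}}).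
Hypothesis phi_inj : injective phi.
Hypothesis phiC : forall c, phi c%:MP = (theta c)%:P.
Hypothesis phi_unif : exists f g : {mpoly k[n]},
  [/\ f != 0, g != 0 & lowdeg (phi f) = (lowdeg (phi g)).+1].

Local Notation K := (ratfun k n).
Local Notation "f %:F" := (@ratfun_of_poly k n f) (at level 1, format "f %:F").
Implicit Types (f g : {mpoly k[n]}) (z : K).

Lemma phi_eq0 f : (phi f == 0) = (f == 0).
Proof. by rewrite -(inj_eq phi_inj) rmorph0. Qed.

Lemma ratfun_div z : exists f g, g != 0 /\ z = f%:F / g%:F.
Proof. exact: fraction_div. Qed.

Definition numer z : {mpoly k[n]} := sval (cid (ratfun_div z)).
Definition denom z : {mpoly k[n]} := sval (cid (svalP (cid (ratfun_div z)))).

Lemma denom_neq0 z : denom z != 0.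
Proof. exact: (svalP (cid (svalP (cid (ratfun_div z))))).1. Qed.

Lemma numer_denom z : z = (numer z)%:F / (denom z)%:F.
Proof. exact: (svalP (cid (svalP (cid (ratfun_div z))))).2. Qed.

Definition pullback_value z : int :=
  (lowdeg (phi (numer z)))%:Z - (lowdeg (phi (denom z)))%:Z.

(** Independence of the chosen fraction: two fractions for one element have equal cross products,
    and [lowdeg] is additive on products. *)
Lemma pullback_valueE f g : f != 0 -> g != 0 ->
  pullback_value (f%:F / g%:F) = (lowdeg (phi f))%:Z - (lowdeg (phi g))%:Z.
Proof.
move=> f0 g0; rewrite /pullback_value; set z := _ / _.
have z0 : z != 0 by rewrite mulf_neq0 ?invr_eq0 ?ratfun_of_poly_eq0.
have d0 := denom_neq0 z; have zE := numer_denom z.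
have n0 : numer z != 0.
  by apply: contraNneq z0 => n0; rewrite zE n0 rmorph0 mul0r.
have eqM : f * denom z = numer z * g.
  apply/eqP; rewrite -(@tofrac_eq {mpoly k[n]}) !tofracM.
  by rewrite -eqr_div ?tofrac_eq0 //; apply/eqP.
have := congr1 (fun h => lowdeg (phi h)) eqM.
by rewrite !rmorphM /= !lowdegM ?phi_eq0 //; lia.
Qed.

Lemma ratfun_neq0_div z : z != 0 -> exists f g, [/\ f != 0, g != 0 & z = f%:F / g%:F].
Proof.
move=> z0; have [f [g [g0 zE]]] := ratfun_div z; exists f, g; split=> //.
by apply: contraNneq z0 => f0; rewrite zE f0 rmorph0 mul0r.
Qed.

Lemma pullback_valueM (x y : K) : x != 0 -> y != 0 ->
  pullback_value (x * y) = pullback_value x + pullback_value y.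
Proof.
move=> /ratfun_neq0_div[f [g [f0 g0 ->]]] /ratfun_neq0_div[f' [g' [f'0 g'0 ->]]].
rewrite mulf_div -!rmorphM /= !pullback_valueE ?mulf_neq0 // !rmorphM /=.
by rewrite !lowdegM ?phi_eq0 //; lia.
Qed.

Lemma pullback_valueD (x y : K) : x != 0 -> y != 0 -> x + y != 0 ->
  Num.min (pullback_value x) (pullback_value y) <= pullback_value (x + y).
Proof.
move=> /ratfun_neq0_div[f [g [f0 g0 ->]]] /ratfun_neq0_div[f' [g' [f'0 g'0 ->]]].
rewrite addf_div ?ratfun_of_poly_eq0 // -!rmorphM -rmorphD /= => s0.
have {}s0 : f * g' + f' * g != 0.
  by apply: contraNneq s0 => ->; rewrite rmorph0 mul0r.
rewrite !pullback_valueE ?mulf_neq0 // rmorphM /= lowdegM ?phi_eq0 //.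
have : phi (f * g') + phi (f' * g) != 0 by rewrite -rmorphD phi_eq0.
move=> /lowdegD; rewrite -rmorphD !rmorphM !lowdegM ?phi_eq0 //.
move: (lowdeg _) (lowdeg _) (lowdeg _) (lowdeg _) (lowdeg _) => a b c d e h.
by lia.
Qed.

Lemma pullback_value_trivial c : c != 0 -> pullback_value (ratfun_const k n c) = 0.
Proof.
move=> c0; have -> : ratfun_const k n c = c%:MP%:F / 1%:F.
  by rewrite rmorph1 divr1.
rewrite pullback_valueE ?mpolyC_eq0 ?oner_eq0 // rmorph1 phiC !lowdegC ?oner_eq0 //.
by rewrite fmorph_eq0.
Qed.

Lemma pullback_value_onto m : exists2 z, z != 0 & pullback_value z = m.
Proof.
have [f [g [f0 g0 fg]]] := phi_unif.
have lowX h l : h != 0 -> lowdeg (phi (h ^+ l)) = (lowdeg (phi h) * l)%N.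
  move=> h0; rewrite rmorphXn; apply: initial_lowdegE (initialX l (initial_lowdeg _)).
  by rewrite expf_neq0 // lowdeg_neq0 // phi_eq0.
have [l [->|->]] : exists l : nat, m = l%:Z \/ m = - l%:Z by exists `|m|%N; lia.
  exists ((f ^+ l)%:F / (g ^+ l)%:F).
    by rewrite mulf_neq0 ?invr_eq0 ?ratfun_of_poly_eq0 ?expf_neq0.
  by rewrite pullback_valueE ?expf_neq0 // !lowX // fg; lia.
exists ((g ^+ l)%:F / (f ^+ l)%:F).
  by rewrite mulf_neq0 ?invr_eq0 ?ratfun_of_poly_eq0 ?expf_neq0.
by rewrite pullback_valueE ?expf_neq0 // !lowX // fg; lia.
Qed.

Definition pullback_valuation : valuation (ratfun_const k n) :=
  Valuation pullback_valueM pullback_valueD pullback_value_trivial pullback_value_onto.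

Local Notation v := pullback_valuation.

Lemma vge_pullback m f g : g != 0 -> f%:F / g%:F \in vge v m%:Z <->
  initial (m + lowdeg (phi g)) (phi f) (phi f)`_(m + lowdeg (phi g)).
Proof.
move=> g0; rewrite unfold_in mulf_eq0 invr_eq0 !ratfun_of_poly_eq0 (negPf g0) orbF.
have [->|f0] /= := eqVneq f 0; first by rewrite rmorph0 coef0; split=> // _; apply: initial0.
by rewrite initial_geq ?phi_eq0 // pullback_valueE //; lia.
Qed.

Lemma vgt_pullback m f g : g != 0 -> f%:F / g%:F \in vgt v m%:Z <->
  initial (m + lowdeg (phi g)) (phi f) 0.
Proof.
move=> g0; rewrite unfold_in mulf_eq0 invr_eq0 !ratfun_of_poly_eq0 (negPf g0) orbF.
have [->|f0] /= := eqVneq f 0; first by rewrite rmorph0; split=> // _; apply: initial0.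
by rewrite initial_gt ?phi_eq0 // pullback_valueE //; lia.
Qed.

Section Centered.

Hypothesis phi0 : forall f, (phi f)`_0 = theta f.@[fun=> 0].

Lemma lowdeg_denominator g : g.@[fun=> 0] != 0 -> lowdeg (phi g) = 0%N.
Proof.
move=> g0; apply: (@initial_lowdegE _ _ _ (theta g.@[fun=> 0])).
  by rewrite fmorph_eq0.
by split=> //; apply: phi0.
Qed.

Lemma centered_pullback : centered_at_origin v.
Proof.
split=> z /asboolP[f [g]] => [[g0 ->]|[f0 g0 ->]].
  have gn0 : g != 0 by apply: contraNneq g0 => ->; rewrite meval0.
  move=> z0; have : f%:F / g%:F \in vge v 0%N%:Z.
    by apply/vge_pullback => //; rewrite lowdeg_denominator.
  by rewrite unfold_in (negPf z0).
have gn0 : g != 0 by apply: contraNneq g0 => ->; rewrite meval0.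
move=> z0; have : f%:F / g%:F \in vgt v 0%N%:Z.
  by apply/vgt_pullback => //; rewrite lowdeg_denominator //; split=> //;
    have := phi0 f; rewrite f0 rmorph0.
by rewrite unfold_in (negPf z0).
Qed.

End Centered.

End PullbackValuation.

(** * Counting monomials *)

Lemma leq_expW a b n : (a <= b -> a ^ n <= b ^ n)%N.
Proof. by case: n => [|n] // ab; rewrite leq_exp2r. Qed.

(** The matrix has rank at most [#|J|], so its left kernel contains a nonzero row. *)
Lemma linear_dependence (k : fieldType) (I J : finType) (F : I -> J -> k) :
  (#|J| < #|I|)%N ->
  exists r : I -> k, (exists i, r i != 0) /\ forall j, \sum_i r i * F i j = 0.
Proof.
move=> JI; pose A := \matrix_(i < #|I|, j < #|J|) F (enum_val i) (enum_val j).
have kA : kermx A != 0.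
  rewrite -mxrank_eq0 mxrank_ker subn_eq0 -ltnNge.
  exact: leq_ltn_trans (rank_leq_col A) JI.
pose u := nz_row (kermx A).
have u0 : u != 0 by rewrite nz_row_eq0.
have uA : u *m A = 0 by apply/sub_kermxP/nz_row_sub.
exists (fun i => u 0 (enum_rank i)); split.
  have /rV0Pn[i ui] := u0; exists (enum_val i); by rewrite enum_valK.
move=> j; have /matrixP/(_ 0 (enum_rank j)) := uA.
rewrite !mxE => uAj; rewrite (reindex (@enum_val I I)) /=.
  rewrite -{2}uAj; apply: eq_bigr => i _.
  by rewrite enum_valK !mxE enum_rankK.
exact: onW_bij (enum_val_bij I).
Qed.

(** Only growth rates matter later, so boxes of exponents suffice: degree at most [b] bounds each
    exponent by [b], and in the next lemma exponents at most [b] give degree at most [n * b]. *)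
Lemma card_bmultinom_le n b : (#|{: 'X_{1..n < b.+1}}| <= b.+1 ^ n)%N.
Proof.
pose h (m : 'X_{1..n < b.+1}) : {ffun 'I_n -> 'I_b.+1} :=
  [ffun i => inord ((m : 'X_{1..n}) i)].
have lem (m : 'X_{1..n < b.+1}) i : ((m : 'X_{1..n}) i < b.+1)%N.
  by apply: leq_ltn_trans (bmdeg m); rewrite mdegE (bigD1 i) //= leq_addr.
have /leq_card : injective h.
  move=> m m' /ffunP hm; apply/val_inj/mnmP => i.
  by have := congr1 (@nat_of_ord _) (hm i); rewrite !ffunE !inordK.
by rewrite card_ffun !card_ord.
Qed.

Lemma card_bmultinom_ge n b : (b.+1 ^ n <= #|{: 'X_{1..n < (n * b).+1}}|)%N.
Proof.
have lem (a : {ffun 'I_n -> 'I_b.+1}) : (mdeg [multinom (a i : nat) | i < n] < (n * b).+1)%N.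
  rewrite ltnS mdegE -[X in (_ <= X * _)%N]card_ord -sum_nat_const.
  by apply: leq_sum => i _; rewrite mnmE -ltnS.
pose h a := BMultinom (lem a).
have /leq_card : injective h.
  move=> a a' /(congr1 val)/mnmP haa; apply/ffunP => i; apply: val_inj.
  by have := haa i; rewrite !mnmE.
by rewrite card_ffun !card_ord.
Qed.

(** * Homogenised relations and algebraic dependence *)

Section Homogenization.

Variables (k : fieldType) (l n : nat).

(* [g ^+ M * P (f / g)], cleared of denominators when [msize P <= M.+1]. *)
Definition homogenization (f : 'I_l -> {mpoly k[n]}) (g : {mpoly k[n]}) (M : nat)
    (P : {mpoly k[l]}) : {mpoly k[n]} :=
  \sum_(m : 'X_{1..l < M.+1}) P@_m *: (mmap1 f m * g ^+ (M - mdeg m)).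

Lemma homogenization_mul (f : 'I_l -> {mpoly k[n]}) g M (A : comNzRingType)
    (i : {rmorphism k -> A}) (h : {rmorphism {mpoly k[n]} -> A}) (z : 'I_l -> A) P :
  (forall c, h c%:MP = i c) -> (forall j, h (f j) = z j * h g) ->
  (msize P <= M.+1)%N ->
  h (homogenization f g M P) = mmap i z P * h g ^+ M.
Proof.
move=> hi hz PM; rewrite (mmapE _ PM) mulr_suml rmorph_sum; apply: eq_bigr => m _.
rewrite -mul_mpolyC !rmorphM hi /mmap1 rmorph_prod -!mulrA; congr (_ * _).
have mM : (mdeg m <= M)%N by rewrite -ltnS bmdeg.
have -> : h g ^+ M = h g ^+ mdeg m * h g ^+ (M - mdeg m) by rewrite -exprD subnKC.
rewrite rmorphXn mulrA; congr (_ * _).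
rewrite mdegE -prodrXr -big_split; apply: eq_bigr => j _ /=.
by rewrite rmorphXn hz exprMn.
Qed.

End Homogenization.

Lemma homogenization_X (k : fieldType) n (g : {mpoly k[n]}) M P :
  (msize P <= M.+1)%N -> homogenization (fun i => 'X_i * g) g M P = P * g ^+ M.
Proof.
move=> PM; have -> : homogenization (fun i => 'X_i * g) g M P =
    idfun (homogenization (fun i => 'X_i * g) g M P) by [].
rewrite (@homogenization_mul _ _ _ _ _ _ _ (@mpolyC n k) _ (fun i => 'X_i)) //.
congr (_ * _); rewrite -[LHS]/(map_mpoly idfun P).
by apply/mpolyP => m; rewrite mcoeff_map_mpoly.
Qed.

Lemma msizeM_leq (k : fieldType) n (p q : {mpoly k[n]}) :
  (msize (p * q) <= (msize p + msize q).-1)%N.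
Proof.
have [->|p0] := eqVneq p 0; first by rewrite mul0r msize0.
have [->|q0] := eqVneq q 0; first by rewrite mulr0 msize0.
by rewrite msizeM.
Qed.

Lemma msizeX_leq (k : fieldType) n (p : {mpoly k[n]}) e j :
  (msize p <= e.+1)%N -> (msize (p ^+ j) <= (e * j).+1)%N.
Proof.
move=> pe; elim: j => [|j IH]; first by rewrite expr0 msize1.
rewrite exprS; have := msizeM_leq p (p ^+ j).
by move: pe IH; move: (msize _) (msize _) (msize _); lia.
Qed.

Lemma msize_mmap1 (k : fieldType) l n (f : 'I_l -> {mpoly k[n]}) e m :
  (forall i, msize (f i) <= e.+1)%N -> (msize (mmap1 f m) <= (e * mdeg m).+1)%N.
Proof.
move=> fe; rewrite mdegE big_distrr /= /mmap1.
elim/big_rec2: _ => [|i a p _ IH]; first by rewrite msize1.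
have := msizeM_leq (f i ^+ m i) a; have := msizeX_leq (m i) (fe i).
by move: IH; move: (msize _) (msize _) (msize _); lia.
Qed.

(** Dimension count: the products of [M] factors among the [f i] and [g], indexed by monomials in n
    + 1 variables, outnumber the monomials in n variables that can occur in them. *)
Lemma algebraic_dependence (k : fieldType) n (f : 'I_n.+1 -> {mpoly k[n]}) g :
  exists M P, [/\ P != 0, (msize P <= M.+1)%N & homogenization f g M P = 0].
Proof.
have [e [fe ge]] : exists e, (forall i, msize (f i) <= e.+1)%N /\ (msize g <= e.+1)%N.
  exists (\max_i msize (f i) + msize g)%N; split=> [i|]; last by lia.
  have : (msize (f i) <= \max_i msize (f i))%N by apply: leq_bigmax.
  by lia.
(* Chosen so that (e M + 1)^n <= (d N)^n = N^(n+1) < (N + 1)^(n+1). The left side bounds the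
   monomials of degree at most e M in n variables, the right side is at most the number of those of
   degree at most M in n + 1 variables. *)
pose d := (n.+1 * e).+1; pose N := (d ^ n)%N; pose M := (n.+1 * N)%N.
pose F (m : 'X_{1..n.+1 < M.+1}) := mmap1 f m * g ^+ (M - mdeg m).
have sizeF m : (msize (F m) <= (e * M).+1)%N.
  have mM : (mdeg m <= M)%N by rewrite -ltnS bmdeg.
  apply: leq_trans (msizeM_leq _ _) _.
  have := msize_mmap1 m fe.
  have := msizeX_leq (M - mdeg m) ge.
  move: (msize _) (msize _) => x y; nia.
have card_lt : (#|{: 'X_{1..n < (e * M).+1}}| < #|{: 'X_{1..n.+1 < M.+1}}|)%N.
  apply: leq_ltn_trans (card_bmultinom_le _ _) _.
  apply: leq_trans (card_bmultinom_ge _ _).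
  have N0 : (0 < N)%N by rewrite expn_gt0.
  have le : ((e * M).+1 <= d * N)%N by rewrite /d /M; nia.
  apply: (@leq_ltn_trans ((d * N) ^ n)%N); first exact: leq_expW.
  rewrite expnMn -/N expnS.
  apply: (@leq_trans (N.+1 * N ^ n)%N); first by rewrite ltn_pmul2r ?expn_gt0 ?N0.
  by rewrite leq_mul // leq_expW.
have [r [[m0 rm0] rF]] := linear_dependence (fun m j => (F m)@_(val j)) card_lt.
pose P : {mpoly k[n.+1]} := \sum_(m : 'X_{1..n.+1 < M.+1}) r m *: 'X_[m].
have Pr (m : 'X_{1..n.+1 < M.+1}) : P@_m = r m.
  rewrite /P raddf_sum (bigD1 m) //= mcoeffZ mcoeffX eqxx mulr1 big1 ?addr0 // => m' m'm.
  by rewrite mcoeffZ mcoeffX -bmeqP (negPf m'm) mulr0.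
exists M, P; split.
- by apply: contraNneq rm0 => P0; rewrite -Pr P0 mcoeff0.
- rewrite (leq_trans (msize_sum _ _ _)) //; apply/bigmax_leqP => m _.
  by rewrite (leq_trans (msizeZ_le _ _)) // msizeX bmdeg.
have HE : homogenization f g M P = \sum_(m : 'X_{1..n.+1 < M.+1}) r m *: F m.
  by apply: eq_bigr => m _; rewrite Pr.
rewrite HE; apply/mpolyP => m; rewrite mcoeff0 raddf_sum /=.
have [mM|mM] := ltnP (mdeg m) (e * M).+1.
  rewrite -[RHS](rF (BMultinom mM)); apply: eq_bigr => m' _.
  by rewrite mcoeffZ.
rewrite big1 // => m' _; rewrite mcoeffZ [X in _ * X]memN_msupp_eq0 ?mulr0 //.
by apply: msize_mdeg_ge; apply: leq_trans mM; apply: sizeF.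
Qed.

(** * Transcendence degree of the residue field *)

Section MmapComp.

Variables (k A B : comNzRingType) (n : nat).
Variables (i : {rmorphism k -> A}) (h : {rmorphism A -> B}).

Lemma rmorph_mmap (j : {rmorphism k -> B}) (z : 'I_n -> A) (P : {mpoly k[n]}) :
  (forall c, h (i c) = j c) -> h (mmap i z P) = mmap j (h \o z) P.
Proof.
move=> hi; rewrite /mmap rmorph_sum; apply: eq_bigr => m _.
rewrite rmorphM hi /mmap1 rmorph_prod; congr (_ * _).
by apply: eq_bigr => u _; rewrite rmorphXn.
Qed.

End MmapComp.

Section ResidueField.

Variables (k K : fieldType) (iota : {rmorphism k -> K}) (v : valuation iota).

Lemma residue_eq0 (y : valuation_ring v) :
  \pi_{ideal_quot (valuation_ideal (v:=v))} y = 0 <-> val y \in vgt v 0.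
Proof.
rewrite -(rmorph0 \pi_{ideal_quot (valuation_ideal (v:=v))}) -valuation_idealE.
by rewrite (rwP eqP) -(Quotient.idealrBE (valuation_ideal (v:=v))) subr0.
Qed.

Lemma residue_mmap_eq0 n (x : 'I_n -> valuation_ring v) (P : {mpoly k[n]}) :
  mmap (residue_const v)
    (fun i => \pi_{ideal_quot (valuation_ideal (v:=v))} (x i)) P = 0 <->
  mmap iota (fun i => val (x i)) P \in vgt v 0.
Proof.
(* The value of [P] computed inside the valuation ring, from which both reduction and inclusion into
   [K] are ring morphisms. *)
pose y : valuation_ring v := \sum_(m <- msupp P)
  ValuationRing (vge_iota v P@_m) * mmap1 x m.
have -> : mmap (residue_const v)
    (fun i => \pi_{ideal_quot (valuation_ideal (v:=v))} (x i)) P =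
    \pi_{ideal_quot (valuation_ideal (v:=v))} y.
  rewrite rmorph_sum; apply: eq_bigr => m _; rewrite rmorphM; congr (_ * _).
  by rewrite rmorph_prod; apply: eq_bigr => i _; rewrite rmorphXn.
have -> : mmap iota (fun i => val (x i)) P = val y.
  rewrite rmorph_sum; apply: eq_bigr => m _; rewrite rmorphM; congr (_ * _).
  by rewrite rmorph_prod; apply: eq_bigr => i _; rewrite rmorphXn.
exact: residue_eq0.
Qed.

End ResidueField.

Section ResidueTranscendenceDegree.

Variables (k K : fieldType) (iota : {rmorphism k -> K}) (v : valuation iota).
Variables (n l : nat) (F : {rmorphism {mpoly k[n]} -> K}).
Variable (phi : {rmorphism {mpoly k[n]} -> {poly {mpoly k[l]}}}).
Hypothesis F_const : forall c, F c%:MP = iota c.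
Hypothesis F_inj : injective F.
Hypothesis F_frac : forall (I : finType) (z : I -> K),
  exists (f : I -> {mpoly k[n]}) (g : {mpoly k[n]}),
    g != 0 /\ forall i, z i = F (f i) / F g.
Hypothesis phi_inj : injective phi.
Hypothesis phiC : forall c, phi c%:MP = (@mpolyC l k c)%:P.
Hypothesis vge0P : forall f g : {mpoly k[n]}, g != 0 ->
  F f / F g \in vge v 0 <-> initial (lowdeg (phi g)) (phi f) (phi f)`_(lowdeg (phi g)).
Hypothesis vgt0P : forall f g : {mpoly k[n]}, g != 0 ->
  F f / F g \in vgt v 0 <-> initial (lowdeg (phi g)) (phi f) 0.

Local Notation residue := (\pi_{ideal_quot (valuation_ideal (v:=v))}).

(** Up to a scalar every term is a product of exactly [M] factors among the [f i] and [g], so all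
    terms start at the same order [e * M] and their coefficients there add up. *)
Lemma initial_homogenization m (f : 'I_m -> {mpoly k[n]}) g
    (a : 'I_m -> {mpoly k[l]}) b e M P :
  (forall i, initial e (phi (f i)) (a i)) -> initial e (phi g) b ->
  initial (e * M) (phi (homogenization f g M P)) (homogenization a b M P).
Proof.
move=> fa gb; rewrite /homogenization rmorph_sum; apply: initial_sum => u _.
rewrite -!mul_mpolyC !rmorphM phiC.
have -> : (e * M = 0 + (e * mdeg u + e * (M - mdeg u)))%N.
  by rewrite add0n -mulnDr subnKC // -ltnS bmdeg.
apply: initialM; first exact: initialC.
rewrite rmorphXn; apply: initialM; last exact: initialX.
rewrite mdegE big_distrr /= /mmap1 rmorph_prod; apply: initial_prod => i.
by rewrite rmorphXn; apply: initialX.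
Qed.

(** The residue of [F (f i) / F g] behaves as the fraction a i / b, so relations between residues
    are relations between these fractions, cleared of denominators. *)
Lemma mmap_vgt m (f : 'I_m -> {mpoly k[n]}) g
    (a : 'I_m -> {mpoly k[l]}) b e M P :
  b != 0 -> (forall i, initial e (phi (f i)) (a i)) -> initial e (phi g) b ->
  (msize P <= M.+1)%N ->
  mmap iota (fun i => F (f i) / F g) P \in vgt v 0 <-> homogenization a b M P = 0.
Proof.
move=> b0 fa gb PM.
have g0 : g != 0.
  apply: contraNneq b0 => g0; have [_ <-] := gb.
  by rewrite g0 rmorph0 coef0.
have Fg0 : F g != 0 by rewrite -(rmorph0 F) (inj_eq F_inj).
have gM0 : g ^+ M != 0 by rewrite expf_neq0.
have -> : mmap iota (fun i => F (f i) / F g) P =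
    F (homogenization f g M P) / F (g ^+ M).
  rewrite (homogenization_mul (h := F) (i := iota) (z := fun i => F (f i) / F g)) //.
    by rewrite rmorphXn mulfK // expf_neq0.
  by move=> j; rewrite divfK.
have H := initial_homogenization M P fa gb.
have low : lowdeg (phi (g ^+ M)) = (e * M)%N.
  by rewrite rmorphXn; apply: initial_lowdegE (initialX M gb); rewrite expf_neq0.
rewrite vgt0P // low; split=> [/initial_inj/(_ H) //|H0].
by rewrite H0 in H.
Qed.

Lemma residue_independent (a : 'I_l -> {mpoly k[n]}) (b : {mpoly k[n]}) :
  b != 0 -> (forall i, phi (a i) = ('X_i)%:P * phi b) ->
  exists u : 'I_l -> residue_field v, algebraically_independent (residue_const v) u.
Proof.
move=> b0 ha.
have hb := initial_lowdeg (phi b); set e := lowdeg _ in hb.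
set c := _`_ e in hb.
have c0 : c != 0 by rewrite lowdeg_neq0 // -(rmorph0 phi) (inj_eq phi_inj).
have ai i : initial e (phi (a i)) ('X_i * c).
  by rewrite ha -[e]add0n; apply: initialM hb; apply: initialC.
have in0 i : F (a i) / F b \in valuation_ring_pred v.
  by apply/(vge0P (a i) b0); have [? e2] := ai i; rewrite e2.
exists (fun i => residue (ValuationRing (in0 i))) => P /residue_mmap_eq0 /=.
rewrite (mmap_vgt c0 ai hb (leqnSn _)) homogenization_X //.
by move/eqP; rewrite mulf_eq0 expf_eq0 (negPf c0) andbF orbF => /eqP.
Qed.

(** Over a common denominator, the residues become quotients of polynomials in [l] variables, and
    [l.+1] such quotients satisfy a relation by [algebraic_dependence]. *)
Lemma residue_dependent (u : 'I_l.+1 -> residue_field v) :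
  ~ algebraically_independent (residue_const v) u.
Proof.
move=> ind; pose x i := repr (u i).
have uE i : u i = residue (x i) by rewrite reprK.
have [f [g [g0 fg]]] := F_frac (fun i => val (x i)).
have hb := initial_lowdeg (phi g); set e := lowdeg _ in hb.
set c := _`_ e in hb.
have c0 : c != 0 by rewrite lowdeg_neq0 // -(rmorph0 phi) (inj_eq phi_inj).
have ai i : initial e (phi (f i)) (phi (f i))`_e.
  by apply/(vge0P (f i) g0); rewrite -fg; apply: valP (x i).
have [M [P [P0 PM H]]] := algebraic_dependence (fun i => (phi (f i))`_e) c.
move/eqP: P0; apply; apply: ind.
have -> : u = fun i => residue (x i) by apply/funext => i; rewrite -uE.
apply/residue_mmap_eq0.
have -> : (fun i => val (x i)) = (fun i => F (f i) / F g) by apply/funext => i; rewrite fg.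
by apply/(mmap_vgt c0 ai hb PM).
Qed.

Lemma residue_transcendence_degree :
  (forall i : 'I_l, exists f g : {mpoly k[n]}, g != 0 /\ phi f = ('X_i)%:P * phi g) ->
  transcendence_degree_is (residue_const v) l.
Proof.
move=> gen; split; last exact: residue_dependent.
have /choice[f /choice[g fg]] := gen.
pose b := \prod_j g j; pose a i := f i * \prod_(j | j != i) g j.
have b0 : b != 0 by apply/prodf_neq0 => i _; have [] := fg i.
apply: (residue_independent (a := a) b0) => i; have [_ fi] := fg i.
by rewrite /a /b [X in _ = _ * phi X](bigD1 i) //= !rmorphM fi mulrA.
Qed.

End ResidueTranscendenceDegree.

(** * The cuspidal valuation *)

(** This is u = (z - y^2 - y^3) / y^9 with y = Y / X and z = Z / X, numerator and denominator being
    multiplied by X^9. *)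
Lemma cuspidal_identity (A B : comNzRingType) (h : {rmorphism A -> B})
    (X Y Z : A) (a t c : B) :
  h X = a * t -> h Y = a * t ^+ 2 -> h Z = a * (t ^+ 3 + t ^+ 4 + c * t ^+ 10) ->
  h (Z * X ^+ 8 - X ^+ 7 * Y ^+ 2 - X ^+ 6 * Y ^+ 3) = c * h (Y ^+ 9).
Proof. by move=> hX hY hZ; rewrite !(rmorphB, rmorphXn, rmorphM) hX hY hZ; ring. Qed.

Section CuspidalEmbedding.

Variable k : fieldType.

Local Notation S := {mpoly k[3]}.
Local Notation x := ('X_(o 3 0) : S).
Local Notation w := ('X_(o 3 1) : S).
Local Notation u := ('X_(o 3 2) : S).
Local Notation tau := ('X : {poly S}).

(* The images of [X], [Y], [Z], [W]. With [y = Y / X] and [z = Z / X] these say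
   [X = x tau], [y = tau], [z = y^2 + y^3 + u y^9] and [W = w tau]. *)
Definition cuspidal_gens (i : 'I_4) : {poly S} :=
  nth 0 [:: x%:P * tau; x%:P * tau ^+ 2;
    x%:P * (tau ^+ 3 + tau ^+ 4 + u%:P * tau ^+ 10); w%:P * tau] i.

Definition cuspidal_embedding : {rmorphism {mpoly k[4]} -> {poly S}} :=
  mmap (polyC \o @mpolyC 3 k) cuspidal_gens.

Local Notation phi := cuspidal_embedding.

Lemma cuspidal_embeddingC c : phi c%:MP = (c%:MP)%:P.
Proof. exact: mmapC. Qed.

Lemma cuspidal_embeddingX i : phi 'X_i = cuspidal_gens i.
Proof. by rewrite /phi /= mmapX mmap1U. Qed.

Lemma mpolyX_neq0 n (i : 'I_n) : 'X_i != 0 :> {mpoly k[n]}.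
Proof.
by apply/eqP => /(congr1 (mcoeff U_(i)%MM))/eqP; rewrite mcoeffXU eqxx mcoeff0 oner_eq0.
Qed.

Lemma initial_tau (c : S) n : initial n (c%:P * tau ^+ n) c.
Proof.
split=> [i im|]; last by rewrite coefCM coefXn eqxx mulr1.
by rewrite coefCM coefXn ltn_eqF ?mulr0.
Qed.

Lemma cuspidal_embedding_unif : exists f g : {mpoly k[4]},
  [/\ f != 0, g != 0 & lowdeg (phi f) = (lowdeg (phi g)).+1].
Proof.
exists 'X_(o 4 1), 'X_(o 4 0); rewrite !mpolyX_neq0 !cuspidal_embeddingX /cuspidal_gens /=.
split=> //; rewrite (initial_lowdegE _ (initial_tau x 2)) ?mpolyX_neq0 //.
by rewrite (initial_lowdegE _ (initial_tau x 1)) ?mpolyX_neq0.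
Qed.

Lemma cuspidal_embedding0 f : (phi f)`_0 = (f.@[fun=> 0])%:MP.
Proof.
have -> : (phi f)`_0 = mmap (@mpolyC 3 k) (coefp 0 \o cuspidal_gens) f.
  by rewrite -[LHS]/(coefp 0 (phi f)); apply: rmorph_mmap => c; rewrite /= coefC.
have -> : (f.@[fun=> 0])%:MP = mmap (@mpolyC 3 k) (@mpolyC 3 k \o fun=> 0) f.
  by apply: rmorph_mmap.
apply: eq_bigr => m _; congr (_ * _); apply: mmap1_eq => i /=; rewrite mpolyC0.
case: i => [[|[|[|[|//]]]] iP]; rewrite /cuspidal_gens /= coefCM ?coefD ?coefCM ?coefXn ?coefX /=;
 by rewrite ?mulr0 ?addr0 ?mulr0.
Qed.

Lemma cuspidal_embedding_residue (i : 'I_3) :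
  exists f g : {mpoly k[4]}, g != 0 /\ phi f = ('X_i)%:P * phi g.
Proof.
pose X j : {mpoly k[4]} := 'X_j.
have X0 j : X j != 0 by apply: mpolyX_neq0.
have phiX j : phi (X j) = cuspidal_gens j by apply: cuspidal_embeddingX.
case: i => [[|[|[|//]]] iP]; rewrite (bool_irrelevance iP isT).
- exists (X (o 4 0) ^+ 2), (X (o 4 1)); split=> //.
  by rewrite rmorphXn !phiX /cuspidal_gens /=; ring.
- exists (X (o 4 3) * X (o 4 0)), (X (o 4 1)); split=> //.
  by rewrite rmorphM !phiX /cuspidal_gens /=; ring.
exists (X (o 4 2) * X (o 4 0) ^+ 8 - X (o 4 0) ^+ 7 * X (o 4 1) ^+ 2 -
    X (o 4 0) ^+ 6 * X (o 4 1) ^+ 3),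
  (X (o 4 1) ^+ 9); split; first by rewrite expf_neq0.
by apply: (cuspidal_identity (a := x%:P) (t := tau)); apply: phiX.
Qed.

Lemma mmap_morphism_id n (A : comNzRingType) (i : {rmorphism k -> A})
    (F : {rmorphism {mpoly k[n]} -> A}) f :
  (forall c, F c%:MP = i c) -> mmap i (fun j => F 'X_j) f = F f.
Proof.
move=> Fi; have e : mmap (@mpolyC n k) (fun j => 'X_j) f = f.
  rewrite -[LHS]/(map_mpoly idfun f).
  by apply/mpolyP => m; rewrite mcoeff_map_mpoly.
by rewrite -[in RHS]e; apply/esym/rmorph_mmap.
Qed.

(* The inverse substitution: [tau = Y / X], [x = X^2 / Y], [w = W X / Y]. *)
Lemma cuspidal_embedding_inverse (K : fieldType) (iota : {rmorphism k -> K})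
    (F : {rmorphism {mpoly k[4]} -> K}) :
  (forall c, F c%:MP = iota c) -> (forall i, F 'X_i != 0) ->
  exists psi : {rmorphism {poly S} -> K}, forall f, psi (phi f) = F f.
Proof.
move=> Fi; pose X i := F 'X_i => X0.
pose t := X (o 4 1) / X (o 4 0).
pose x' := X (o 4 0) ^+ 2 / X (o 4 1).
pose z : 'I_3 -> K := fun i => nth 0 [:: x'; X (o 4 3) * X (o 4 0) / X (o 4 1);
  (X (o 4 2) / x' - t ^+ 3 - t ^+ 4) / t ^+ 10] i.
pose j : {rmorphism S -> K} := mmap iota z.
have cj : commr_rmorph j t by move=> a; apply: mulrC.
pose psi : {rmorphism {poly S} -> K} := horner_morph cj.
have psiC c : psi c%:P = j c by apply: horner_morphC.
have psiX : psi tau = t by apply: horner_morphX.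
have jX i : j 'X_i = z i by rewrite /j /= mmapX mmap1U.
exists psi => f.
have -> : psi (phi f) = mmap iota (psi \o cuspidal_gens) f.
  by apply: rmorph_mmap => c; rewrite [LHS]psiC [LHS]mmapC.
rewrite -(mmap_morphism_id f Fi); apply: eq_bigr => m _; congr (_ * _).
apply: mmap1_eq => i; rewrite /= /cuspidal_gens -/(X i).
have t0 : t != 0 by rewrite mulf_neq0 ?invr_eq0 //; apply: X0.
have [X00 X01] : X (o 4 0) != 0 /\ X (o 4 1) != 0 by split; apply: X0.
case: i => [[|[|[|[|//]]]] iP]; rewrite /= ?(rmorphM, rmorphD, rmorphXn, psiC, psiX, jX) /z /=;
  rewrite (bool_irrelevance iP isT).
- by rewrite /x' /t; field; rewrite ?X00 ?X01.
- by rewrite /x' /t; field; rewrite ?X00 ?X01.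
- rewrite divfK ?expf_neq0 //.
  by rewrite /x'; field; rewrite ?X00 ?X01.
- by rewrite /t; field; rewrite ?X00 ?X01.
Qed.

(** The inverse rational substitution recovers [f] from [phi f] inside the field of fractions. *)
Lemma cuspidal_embedding_inj : injective phi.
Proof.
have [c||psi psiE f g fg] :=
  @cuspidal_embedding_inverse _ (ratfun_const k 4) (ratfun_of_poly k 4).
- by [].
- by move=> i; rewrite ratfun_of_poly_eq0 mpolyX_neq0.
by apply/eqP; rewrite -(@tofrac_eq {mpoly k[4]}); apply/eqP; rewrite -[LHS]psiE fg; apply: psiE.
Qed.

Definition cuspidal_valuation : valuation (ratfun_const k 4) :=
  pullback_valuation cuspidal_embedding_inj cuspidal_embeddingC cuspidal_embedding_unif.

Lemma cuspidal_valuation_divisorial : divisorial cuspidal_valuation.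
Proof.
apply: (residue_transcendence_degree (F := ratfun_of_poly k 4) (phi := phi)).
- by [].
- by move=> f g /eqP; rewrite tofrac_eq => /eqP.
- by move=> I z; apply: ratfun_common_denominator.
- exact: cuspidal_embedding_inj.
- exact: cuspidal_embeddingC.
- by move=> f g g0; apply: (vge_pullback _ _ _ 0 f g0).
- by move=> f g g0; apply: (vgt_pullback _ _ _ 0 f g0).
exact: cuspidal_embedding_residue.
Qed.

Lemma cuspidal_valuation_centered : centered_at_origin cuspidal_valuation.
Proof. exact/centered_pullback/cuspidal_embedding0. Qed.

End CuspidalEmbedding.

(** * Restriction to the cuspidal cubic *)

Lemma coef_binomial (k : comNzRingType) a c j :
  ('X^a * (1 + 'X) ^+ c : {poly k})`_j = (if (j < a)%N then 0%N else 'C(c, j - a))%:R.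
Proof.
rewrite coefXnM; case: ifP => // _; rewrite exprDn coef_sum.
have [jc|cj] := leqP (j - a) c.
  have jP : (j - a < c.+1)%N by [].
  rewrite (bigD1 (Ordinal jP)) //= expr1n mul1r coefMn coefXn eqxx.
  rewrite big1 ?addr0 // => i; rewrite -val_eqE /= => ij.
  by rewrite expr1n mul1r coefMn coefXn eq_sym (negPf ij) mul0rn.
rewrite bin_small // big1 // => i _.
rewrite expr1n mul1r coefMn coefXn; case: eqP => [e|_]; last by rewrite mul0rn.
by have := ltn_ord i; lia.
Qed.

Lemma mcoeff_mulX0 (k : comNzRingType) n (i : 'I_n) (p : {mpoly k[n]})
    (m : 'X_{1..n}) :
  m i = 0%N -> ('X_i * p)@_m = 0.
Proof.
move=> mi; apply: memN_msupp_eq0; apply/negP => /msuppM_le/allpairsP[[m1 m2] /= []].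
rewrite msuppX inE => /eqP-> _ e; move: mi.
by rewrite e mnmDE mnm1E eqxx.
Qed.

Lemma mmapX4 (k : nzRingType) (A : comNzRingType) (i : {rmorphism k -> A})
    (h : 'I_4 -> A) (m : 'X_{1..4}) :
  mmap i h 'X_[m] = h (o 4 0) ^+ m (o 4 0) * (h (o 4 1) ^+ m (o 4 1) *
    (h (o 4 2) ^+ m (o 4 2) * h (o 4 3) ^+ m (o 4 3))).
Proof.
rewrite mmapX /mmap1 !big_ord_recl big_ord0 mulr1.
by congr (h _ ^+ m _ * (h _ ^+ m _ * (h _ ^+ m _ * h _ ^+ m _))); apply: val_inj.
Qed.

(** Reduction modulo [u] restricts to the curve, where Z becomes x t^3 (1 + t). The powers of 1 + t
    + u t^7 and of 1 + t differ by a multiple of [u]. *)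
Lemma cuspidal_monomial_identity (A : comNzRingType) (x w u t : A) a b c e :
  exists r, (x * t) ^+ a * ((x * t ^+ 2) ^+ b *
    ((x * (t ^+ 3 + t ^+ 4 + u * t ^+ 10)) ^+ c * (w * t) ^+ e)) =
    u * r + x ^+ (a + b + c) * w ^+ e * (t ^+ (a + 2 * b + 3 * c + e) * (1 + t) ^+ c).
Proof.
have [r hr] : exists r, (1 + t + u * t ^+ 7) ^+ c = (1 + t) ^+ c + u * r.
  case: c => [|c]; first by exists 0; rewrite !expr0 mulr0 addr0.
  have E := subrXX (1 + t + u * t ^+ 7) (1 + t) c.+1.
  rewrite [X in _ = X * _]addrAC subrr add0r -mulrA in E.
  move/eqP: E; rewrite subr_eq => /eqP->; eexists; apply: addrC.
have -> : (x * (t ^+ 3 + t ^+ 4 + u * t ^+ 10)) ^+ c =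
    x ^+ c * t ^+ (3 * c) * ((1 + t) ^+ c + u * r).
  rewrite -hr [t ^+ (3 * c)]exprM -!exprMn; congr (_ ^+ c); ring.
exists ((x ^+ (a + b + c) * w ^+ e) * t ^+ (a + 2 * b + 3 * c + e) * r).
have -> : t ^+ (a + 2 * b + 3 * c + e) = t ^+ a * (t ^+ 2) ^+ b * t ^+ (3 * c) * t ^+ e.
  by rewrite -exprM -!exprD.
move: (t ^+ (3 * c)) => t3; rewrite !exprMn !exprD; ring.
Qed.

Section TopCoefficients.

Variable k : fieldType.

Local Notation S := {mpoly k[3]}.
Local Notation x := ('X_(o 3 0) : S).
Local Notation w := ('X_(o 3 1) : S).
Local Notation u := ('X_(o 3 2) : S).
Local Notation tau := ('X : {poly S}).
Local Notation phi := (cuspidal_embedding k).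

Lemma cuspidal_embedding_monomial (m : 'X_{1..4}) :
  let: (a, b, c, e) := (m (o 4 0), m (o 4 1), m (o 4 2), m (o 4 3)) in
  exists r : {poly S}, phi 'X_[m] = u%:P * r +
    (x ^+ (a + b + c) * w ^+ e)%:P *
    map_poly (@mpolyC 3 k) ('X^(a + 2 * b + 3 * c + e) * (1 + 'X) ^+ c).
Proof.
have [r hr] := cuspidal_monomial_identity x%:P w%:P u%:P tau
  (m (o 4 0)) (m (o 4 1)) (m (o 4 2)) (m (o 4 3)).
exists r; rewrite [LHS]mmapX4 [LHS]hr; congr (_ + _).
congr (_ * _); first by rewrite (rmorphM (@polyC S)) !rmorphXn.
by rewrite rmorphM 2!rmorphXn rmorphD rmorph1 /= map_polyX.
Qed.

(** Here [d] is the degree in X, Y, Z and [l] the degree in W. The bound 4 d + l is the order d + l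
    of x^d w^l tau^(d+l) plus the maximal contact 3 d; the second clause is the linear condition
    that the cusp puts on the two top coefficients. *)
Definition top_related d l (q : {poly S}) (m : 'X_{1..3}) :=
  (forall j, (4 * d + l < j)%N -> (q`_j)@_m = 0) /\
  ((0 < d)%N -> (q`_(4 * d + l).-1)@_m = d%:R * (q`_(4 * d + l))@_m).

(* On the curve [u = 0] a form of degree [d] restricts to a polynomial of
   degree at most [3d] in [tau], and the point at infinity is a cusp. *)
Lemma cuspidal_embedding_top (m : 'X_{1..3}) f :
  m (o 3 2) = 0%N -> top_related (m (o 3 0)) (m (o 3 1)) (phi f) m.
Proof.
move=> m2; elim/mpolyind: f => [|c m' f _ _ [IH1 IH2]].
  by rewrite rmorph0; split=> [j _|_]; rewrite !coef0 !mcoeff0 ?mulr0.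
have phiM : phi (c *: 'X_[m'] + f) = c%:MP%:P * phi 'X_[m'] + phi f.
  by rewrite -mul_mpolyC rmorphD rmorphM cuspidal_embeddingC.
rewrite phiM; move: (phi f) IH1 IH2 => q IH1 IH2 {phiM f}.
suff: top_related (m (o 3 0)) (m (o 3 1)) (phi 'X_[m']) m.
  case; move: (phi _) => p h1 h2.
  split=> [j jd|d0]; rewrite !coefD !coefCM !mcoeffD !mcoeffCM.
    by rewrite h1 ?IH1 // mulr0 addr0.
  by rewrite h2 ?IH2 //; ring.
have [r ->] := cuspidal_embedding_monomial m'.
move: (m' (o 4 0)) (m' (o 4 1)) (m' (o 4 2)) (m' (o 4 3)) => {m' q IH1 IH2} {c} a b c e.
pose mm : 'X_{1..3} := (U_(o 3 0) *+ (a + b + c) + U_(o 3 1) *+ e)%MM.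
have coefE j : ((u%:P * r + (x ^+ (a + b + c) * w ^+ e)%:P * map_poly (@mpolyC 3 k)
    ('X^(a + 2 * b + 3 * c + e) * (1 + 'X) ^+ c))`_j)@_m = (mm == m)%:R *
    (if (j < a + 2 * b + 3 * c + e)%N then 0%N
     else 'C(c, j - (a + 2 * b + 3 * c + e)))%:R.
  rewrite coefD !coefCM mcoeffD mcoeff_mulX0 // add0r coef_map coef_binomial /=.
  rewrite [_ * _%:MP]mulrC mcoeffCM [RHS]mulrC; congr (_ * _).
  by rewrite !mpolyXn -mpolyXD mcoeffX.
have [mE|/negPf mm0] := eqVneq mm m; last first.
  by split=> [j _|_]; rewrite !coefE mm0 !mul0r ?mulr0.
have -> : m (o 3 0) = (a + b + c)%N.
  by rewrite -mE mnmDE !mulmnE !mnm1E /= mul1n mul0n addn0.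
have -> : m (o 3 1) = e by rewrite -mE mnmDE !mulmnE !mnm1E /= mul1n mul0n.
split=> [j jd|d0]; rewrite !coefE mE eqxx !mul1r.
  case: ifP => // _; rewrite bin_small //; lia.
rewrite -natrM; congr (_%:R).
(* Only Z^d reaches the two top places, through the top coefficients 1 and d of (1 + tau)^d.
   Replacing a factor Z by X or Y lowers the degree by at least 2, so both coefficients are then
   0. *)
have [ab0|ab0] := posnP (a + b).
  have [-> ->] : a = 0%N /\ b = 0%N by lia.
  have -> : (4 * (0 + 0 + c) + e - (0 + 2 * 0 + 3 * c + e))%N = c by lia.
  have -> : ((4 * (0 + 0 + c) + e).-1 - (0 + 2 * 0 + 3 * c + e))%N = c.-1 by lia.
  rewrite !ifN; [|lia..]; rewrite binn; case: c d0 {coefE mE mm} => [|c]; first by lia.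
  by rewrite /= binSn; lia.
rewrite !ifN; [|lia..]; rewrite !bin_small; lia.
Qed.

End TopCoefficients.

(** * Forms with large contact *)

Section AffineForms.

Variable k : fieldType.

Local Notation S := {mpoly k[3]}.
Local Notation x := ('X_(o 3 0) : S).
Local Notation u := ('X_(o 3 2) : S).
Local Notation phi := (cuspidal_embedding k).

(* [k[tau][c]], where [c] stands for [u tau^9], the local equation of the curve. *)
Local Notation B := {poly {poly k}}.

Definition chart_const : {rmorphism {poly k} -> {poly S}} := map_poly (@mpolyC 3 k).

Fact chart_comm : commr_rmorph chart_const (u%:P * 'X^9).
Proof. by move=> a; apply: mulrC. Qed.

Definition chart : {rmorphism B -> {poly S}} := horner_morph chart_comm.

Lemma chartC a : chart a%:P = map_poly (@mpolyC 3 k) a.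
Proof. exact: horner_morphC. Qed.

Lemma chartX : chart 'X = u%:P * 'X^9.
Proof. exact: horner_morphX. Qed.

Lemma map_mpolyC_MXn (q : {poly k}) a :
  map_poly (@mpolyC 3 k) (q * 'X^a) = map_poly (@mpolyC 3 k) q * 'X^a.
Proof. by rewrite rmorphM rmorphXn /= map_polyX. Qed.

Lemma map_mpolyC_Xnat a :
  map_poly (@mpolyC 3 k) ('X + a%:R%:P) = 'X + a%:R%:P.
Proof. by rewrite rmorphD /= map_polyX map_polyC /= mpolyC_nat. Qed.

(** It expresses that X^d G(y, z - y^2 - y^3) is a polynomial, hence a form of degree [d] in X, Y,
    Z. *)
Definition affine_form d (G : B) :=
  exists f, phi f = x%:P ^+ d * 'X^d * chart G.

Lemma affine_form0 d : affine_form d 0.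
Proof. by exists 0; rewrite !rmorph0 mulr0. Qed.

Lemma affine_formD d G H : affine_form d G -> affine_form d H -> affine_form d (G + H).
Proof. by move=> [f hf] [g hg]; exists (f + g); rewrite !rmorphD /= hf hg mulrDr. Qed.

Lemma affine_formN d G : affine_form d G -> affine_form d (- G).
Proof. by move=> [f hf]; exists (- f); rewrite !rmorphN /= hf mulrN. Qed.

Lemma affine_formZ d a G : affine_form d G -> affine_form d (a%:P%:P * G).
Proof.
move=> [f hf]; exists (a%:MP * f).
rewrite (rmorphM phi) hf cuspidal_embeddingC (rmorphM chart) chartC map_polyC /=.
by rewrite mulrCA.
Qed.

Lemma affine_formM d e G H :
  affine_form d G -> affine_form e H -> affine_form (d + e) (G * H).
Proof.
move=> [f hf] [g hg]; exists (f * g).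
by rewrite (rmorphM phi) hf hg (rmorphM chart) !exprD; ring.
Qed.

Lemma affine_form1 : affine_form 1 1.
Proof.
by exists 'X_(o 4 0); rewrite cuspidal_embeddingX rmorph1 mulr1 !expr1.
Qed.

Lemma affine_form_tau : affine_form 1 'X%:P.
Proof.
exists 'X_(o 4 1); rewrite cuspidal_embeddingX chartC map_polyX /cuspidal_gens /=.
by rewrite !expr1 -mulrA -expr2.
Qed.

Definition zeta : B := ('X^2 * (1 + 'X))%:P + 'X.

Lemma affine_form_zeta : affine_form 1 zeta.
Proof.
exists 'X_(o 4 2); rewrite cuspidal_embeddingX rmorphD chartC chartX /cuspidal_gens /=.
by rewrite rmorphM rmorphXn rmorphD rmorph1 /= map_polyX !expr1; ring.
Qed.

Lemma affine_form_widen d e G : affine_form d G -> (d <= e)%N -> affine_form e G.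
Proof.
move=> hG de; rewrite -(subnK de); elim: (e - d)%N => [//|i IH].
by rewrite addSn -add1n -[G]mul1r; apply: affine_formM affine_form1 IH.
Qed.

Lemma affine_formX d G n : affine_form d G -> (0 < n)%N -> affine_form (d * n) (G ^+ n).
Proof.
move=> hG; case: n => // n _; elim: n => [|n IH]; first by rewrite muln1 expr1.
by rewrite exprS mulnS; apply: affine_formM.
Qed.

(** The form is the cubic Z X^2 - X Y^2 - Y^3 itself. *)
Lemma affine_form_c : affine_form 3 'X.
Proof.
have tau2 := affine_formX affine_form_tau (isT : (0 < 2)%N).
have tau3 := affine_formX affine_form_tau (isT : (0 < 3)%N).
have -> : 'X = zeta - 'X%:P ^+ 2 - 'X%:P ^+ 3 :> B.
  by rewrite /zeta mulrDr mulr1 -exprSr polyCD !rmorphXn; ring.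
apply: affine_formD; last exact: affine_formN.
apply: affine_formD; last by apply: affine_formN; apply: affine_form_widen tau2 _.
by apply: affine_form_widen affine_form_zeta _.
Qed.

Lemma affine_form_monomial d i j : (0 < d)%N -> (i + j <= d)%N ->
  affine_form d ('X%:P ^+ i * zeta ^+ j).
Proof.
move=> d0 ijd; have [i0|i0] := posnP i; have [j0|j0] := posnP j.
- by rewrite i0 j0 !expr0 mulr1; apply: affine_form_widen affine_form1 _.
- rewrite i0 expr0 mul1r; apply: affine_form_widen (affine_formX affine_form_zeta j0) _; lia.
- rewrite j0 expr0 mulr1; apply: affine_form_widen (affine_formX affine_form_tau i0) _; lia.
have := affine_formM (affine_formX affine_form_tau i0) (affine_formX affine_form_zeta j0).
by rewrite !mul1n => h; apply: affine_form_widen h ijd.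
Qed.

Lemma coef0_monomial i j :
  ('X%:P ^+ i * zeta ^+ j : B)`_0 = 'X^(i + 2 * j) * (1 + 'X) ^+ j.
Proof.
rewrite -[LHS]/(coefp 0 _) rmorphM !rmorphXn /= coefC /=.
by rewrite coefD coefC coefX /= addr0 exprMn -exprM mulrA -exprD.
Qed.

(** On the curve c = 0 the monomial y^i z^j is monic of degree i + 3 j in tau, so leading terms can
    be removed one by one. With i < 3 and i + j <= d these degrees fill the range up to 3 d - 2; the
    degree 3 d - 1 is the gap caused by the cusp. *)
Lemma affine_form_lift d (b : {poly k}) : (0 < d)%N -> (size b <= 3 * d - 1)%N ->
  exists2 G, affine_form d G & G`_0 = b.
Proof.
move=> d0; move: {2}(size b) (leqnn (size b)) => n.
elim: n b => [|n IH] b bn bd.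
  exists 0; first exact: affine_form0.
  by rewrite coef0; apply/esym/eqP; rewrite -size_poly_eq0 -leqn0.
have [bn'|bn'] := leqP (size b) n; first exact: IH.
pose j := (n %/ 3)%N; pose i := (n %% 3)%N.
have nE : n = (j * 3 + i)%N := divn_eq n 3.
have i3 : (i < 3)%N by rewrite ltn_mod.
have ijd : (i + j <= d)%N by lia.
pose G := 'X%:P ^+ i * zeta ^+ j : B.
pose b' := b - b`_n *: G`_0.
have Gn l : (n <= l)%N -> (G`_0)`_l = (l == n)%:R.
  rewrite /G coef0_monomial coef_binomial => nl; rewrite ifN; last by lia.
  have [->|ln] := eqVneq l n; last by rewrite bin_small //; lia.
  have -> : (n - (i + 2 * j))%N = j by lia.
  by rewrite binn.
have b'n : (size b' <= n)%N.
  apply/leq_sizeP => l nl; rewrite coefB coefZ Gn //.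
  have [->|ln] := eqVneq l n; first by rewrite mulr1 subrr.
  rewrite mulr0 subr0 nth_default //; apply: leq_trans bn _; lia.
have [||H hH Hb] := IH b'; [by []|by lia|].
exists (H + (b`_n)%:P%:P * G).
  by apply: affine_formD => //; apply/affine_formZ/affine_form_monomial.
by rewrite coefD coefCM Hb mul_polyC subrK.
Qed.

(** Successive corrections along powers of c: a form of degree 3 (n + 1) matches [G] on the curve
    below order 9 n + 8, and the quotient of the remainder by c is treated by induction, since c has
    degree 3 and order 9. The order reached is 9 n - 1; the factor ['X] avoids the subtraction at n
    = 0. *)
Lemma affine_form_approx n (G : B) : exists2 h, affine_form (3 * n) h &
  exists r, 'X * chart (G - h) = 'X^(9 * n) * r.
Proof.
elim: n G => [|n IH] G.
  exists 0; first exact: affine_form0.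
  by exists ('X * chart (G - 0)); rewrite mul1r.
(* With d = 3 (n + 1) this is 3 d - 1, the largest size that [affine_form_lift] accepts. *)
pose s := (9 * n + 8)%N; pose b := take_poly s G`_0.
have [||G1 hG1 G1b] := @affine_form_lift (3 * n.+1) b; first by lia.
  by apply: leq_trans (size_take_poly _ _) _; rewrite /s; lia.
have [h2 hh2 [r2 er2]] := IH (drop_poly 1 (G - G1)).
exists (G1 + h2 * 'X).
  apply: affine_formD => //; have -> : (3 * n.+1 = 3 * n + 3)%N by lia.
  exact: affine_formM hh2 affine_form_c.
pose q := drop_poly s G`_0.
have G0 : (G - G1)`_0 = q * 'X^s.
  by rewrite coefB G1b /b -{1}(poly_take_drop s G`_0) addrC addKr.
have -> : G - (G1 + h2 * 'X) = (drop_poly 1 (G - G1) - h2) * 'X + (q * 'X^s)%:P.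
  rewrite opprD addrA -{1}(poly_take_drop 1 (G - G1)) expr1.
  have -> : take_poly 1 (G - G1) = (q * 'X^s)%:P.
    by rewrite -G0; apply/polyP => l; rewrite coef_take_poly coefC; case: l.
  by ring.
rewrite (rmorphD chart) (rmorphM chart) chartX chartC map_mpolyC_MXn.
pose c : {poly S} := map_poly (@mpolyC 3 k) q; rewrite -/c.
move: er2; move: (chart _) => a E.
exists (u%:P * r2 + c).
have -> : 'X * (a * (u%:P * 'X^9) + c * 'X^s) =
   u%:P * 'X^9 * ('X * a) + c * 'X^(s.+1) by rewrite (exprS _ s); ring.
have -> : (9 * n.+1 = 9 + 9 * n)%N by lia.
rewrite E; have -> : s.+1 = (9 + 9 * n)%N by rewrite /s; lia.
by rewrite !exprD; ring.
Qed.

(** Start from Z^d and cancel all terms of its restriction to the curve except the top two. The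
    remaining multiple of c is then corrected by c times a form of degree d - 3, up to order 9 + 3
    (d - 3) - 1 = 3 d - 1. *)
Lemma exists_near_top n : exists f (r : {poly S}), let d := (3 * n.+1)%N in
  'X * phi f = (x ^+ d)%:P * 'X^(4 * d) * ('X + d%:R%:P + u%:P * r).
Proof.
set d := (3 * n.+1)%N.
(* The two top terms of tau^(2d) (1 + tau)^d, the restriction of z^d. *)
pose t : {poly k} := ('X + d%:R%:P) * 'X^((3 * d).-1).
pose b := (zeta ^+ d)`_0 - t.
have b_size : (size b <= 3 * d - 1)%N.
  apply/leq_sizeP => j jd; rewrite coefB -[zeta ^+ d]mul1r -[1]/('X%:P ^+ 0).
  have [h1 h2] : (j < 0 + 2 * d)%N = false /\ (j < (3 * d).-1)%N = false by lia.
  rewrite coef0_monomial coef_binomial coefMXn coefD coefX coefC h1 h2.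
  have [->|j1] := eqVneq j (3 * d).-1.
    have -> : ((3 * d).-1 - (0 + 2 * d))%N = d.-1 by lia.
    have -> : ((3 * d).-1 - (3 * d).-1)%N = 0%N by lia.
    by rewrite {1 2}/d /= binSn add0r subrr.
  have [->|j2] := eqVneq j (3 * d)%N.
    have -> : (3 * d - (0 + 2 * d))%N = d by lia.
    have -> : (3 * d - (3 * d).-1)%N = 1%N by lia.
    by rewrite binn addr0 subrr.
  rewrite bin_small; last by lia.
  have [e1 e0] : ((j - (3 * d).-1)%N == 1%N) = false /\
    ((j - (3 * d).-1)%N == 0%N) = false by lia.
  by rewrite e1 e0 addr0 subrr.
have [||G hG Gb] := @affine_form_lift d b; [by lia|by []|].
pose H0 := zeta ^+ d - G.
have H00 : H0`_0 = t by rewrite coefB Gb /b opprB addrC subrK.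
have hH0 : affine_form d H0.
  apply: affine_formD; last exact: affine_formN.
  by have := affine_formX affine_form_zeta (isT : (0 < d)%N); rewrite mul1n.
have [h hh [r er]] := affine_form_approx n (drop_poly 1 H0).
have [f hf] : affine_form d (H0 - h * 'X).
  apply: affine_formD => //; apply: affine_formN.
  have -> : d = (3 * n + 3)%N by rewrite /d; lia.
  exact: affine_formM hh affine_form_c.
exists f, r; move: hf.
have -> : H0 - h * 'X = (drop_poly 1 H0 - h) * 'X + t%:P.
  rewrite -{1}(poly_take_drop 1 H0) expr1.
  have -> : take_poly 1 H0 = t%:P.
    by rewrite -H00; apply/polyP => l; rewrite coef_take_poly coefC; case: l.
  by ring.
rewrite (rmorphD chart) (rmorphM chart) chartX chartC /t map_mpolyC_MXn map_mpolyC_Xnat.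
move: er; move: (chart _) => a E ->.
have -> : 'X * (x%:P ^+ d * 'X^d * (a * (u%:P * 'X^9) + ('X + d%:R%:P) * 'X^((3 * d).-1))) =
  x%:P ^+ d * 'X^d * (u%:P * 'X^9 * ('X * a) + 'X^((3 * d).-1.+1) * ('X + d%:R%:P)) :> {poly S}.
  by rewrite (exprS _ (3 * d).-1); ring.
rewrite E rmorphXn; have -> : (4 * d = d + (9 + 9 * n))%N by rewrite /d; lia.
have -> : (3 * d).-1.+1 = (9 + 9 * n)%N by rewrite /d; lia.
by rewrite !exprD; ring.
Qed.

End AffineForms.

(** * The associated graded ring *)

Section GradedRing.

Variables (k K : fieldType) (iota : {rmorphism k -> K}) (v : valuation iota).
Variables (R : subringClosed K) (iotaR : forall c, iota c \in R).
Variables (n l : nat) (F : {rmorphism {mpoly k[n]} -> K}).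
Variable (phi : {rmorphism {mpoly k[n]} -> {poly {mpoly k[l]}}}).
Implicit Types (f g : {mpoly k[n]}) (c d : {mpoly k[l]}) (N m : nat).

Hypothesis F_const : forall a : k, F a%:MP = iota a.
Hypothesis F_inj : injective F.
Hypothesis phi_const : forall a, phi a%:MP = (a%:MP)%:P.
Hypothesis phi0 : forall f, (phi f)`_0 = (f.@[fun=> 0])%:MP.
Hypothesis R_frac : forall z, z \in R <->
  exists f g, g.@[fun=> 0] != 0 /\ z = F f / F g.
Hypothesis vgeP : forall m f g, g.@[fun=> 0] != 0 ->
  F f / F g \in vge v m%:Z <-> initial m (phi f) (phi f)`_m.
Hypothesis vgtP : forall m f g, g.@[fun=> 0] != 0 ->
  F f / F g \in vgt v m%:Z <-> initial m (phi f) 0.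

(* [cone N m] is the degree [m] part of the [N]-th term of an increasing
   exhaustive family of graded subalgebras, none of which contains all initial
   coefficients. *)
Variable cone : nat -> nat -> {mpoly k[l]} -> Prop.
Hypothesis cone0 : forall N m, cone N m 0.
Hypothesis coneD : forall N m c d, cone N m c -> cone N m d -> cone N m (c + d).
Hypothesis coneM : forall N m m' c d,
  cone N m c -> cone N m' d -> cone N (m + m') (c * d).
Hypothesis coneC : forall N a, cone N 0 a%:MP.
Hypothesis cone_mono : forall N N' m c, (N <= N')%N -> cone N m c -> cone N' m c.
Hypothesis cone_exhaustive : forall m f c, initial m (phi f) c -> exists N, cone N m c.
Hypothesis cone_proper : forall N, exists m f c,
  initial m (phi f) c /\ forall a : k, a != 0 -> ~ cone N m (c * a%:MP).

Local Notation gr := (\pi_{ideal_quot (rees_plus (v:=v) (R:=R))}).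

(** One suitable fraction is enough: since [phi g] starts with the nonzero constant [g.@[fun=> 0]],
    another fraction for [z] changes the initial coefficient only by a nonzero scalar. *)
Definition cone_coef N m (z : K) := exists f g c,
  [/\ g.@[fun=> 0] != 0, z = F f / F g, initial m (phi f) c & cone N m c].

Definition cone_rees N (p : rees v R) := forall m, cone_coef N m (val p)`_m.

Definition cone_gr N (a : graded_ring v R) := exists2 p, cone_rees N p & a = gr p.

Lemma F_denom_neq0 g : g.@[fun=> 0] != 0 -> F g != 0.
Proof.
by move=> g0; rewrite -(rmorph0 F) (inj_eq F_inj); apply: contraNneq g0 => ->; rewrite meval0.
Qed.

Lemma initial_denom g : initial 0 (phi g) (g.@[fun=> 0])%:MP.
Proof. by split=> //; apply: phi0. Qed.

Lemma cone_coef0 N m : cone_coef N m 0.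
Proof.
exists 0, 1, 0; split; rewrite ?meval1 ?oner_eq0 ?rmorph0 ?mul0r //.
exact: initial0.
Qed.

Lemma cone_coefD N m y z : cone_coef N m y -> cone_coef N m z -> cone_coef N m (y + z).
Proof.
move=> [f [g [c [g0 -> fc cc]]]] [f' [g' [c' [g'0 -> fc' cc']]]].
exists (f * g' + f' * g), (g * g'), (c * (g'.@[fun=> 0])%:MP + c' * (g.@[fun=> 0])%:MP).
split.
- by rewrite mevalM mulf_neq0.
- by rewrite addf_div ?F_denom_neq0 // rmorphD !rmorphM.
- rewrite rmorphD !rmorphM; apply: initialD; rewrite -[m]addn0.
    exact: initialM (initial_denom _).
  exact: initialM (initial_denom _).
by apply: coneD; rewrite -[m]addn0; apply: coneM.
Qed.

Lemma cone_coefM N m m' y z :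
  cone_coef N m y -> cone_coef N m' z -> cone_coef N (m + m') (y * z).
Proof.
move=> [f [g [c [g0 -> fc cc]]]] [f' [g' [c' [g'0 -> fc' cc']]]].
exists (f * f'), (g * g'), (c * c'); split.
- by rewrite mevalM mulf_neq0.
- by rewrite mulf_div !rmorphM.
- by rewrite rmorphM; apply: initialM.
exact: coneM.
Qed.

Lemma cone_coef_const N a : cone_coef N 0 (iota a).
Proof.
exists a%:MP, 1, a%:MP; split; rewrite ?meval1 ?oner_eq0 //.
  by rewrite rmorph1 divr1 F_const.
by rewrite phi_const; apply: initialC.
Qed.

Lemma cone_grD N a b : cone_gr N a -> cone_gr N b -> cone_gr N (a + b).
Proof.
move=> [p hp ->] [q hq ->]; exists (p + q); last by rewrite rmorphD.
by move=> m; rewrite rmorphD coefD; apply: cone_coefD.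
Qed.

Lemma cone_grM N a b : cone_gr N a -> cone_gr N b -> cone_gr N (a * b).
Proof.
move=> [p hp ->] [q hq ->]; exists (p * q); last by rewrite rmorphM.
move=> m; rewrite rmorphM coefM; elim/big_rec: _ => [|i z _ hz]; first exact: cone_coef0.
apply: cone_coefD hz; have im : (i <= m)%N by rewrite -ltnS.
by have := cone_coefM (hp i) (hq (m - i)%N); rewrite subnKC.
Qed.

Lemma cone_gr_const N a : cone_gr N (graded_const v iotaR a).
Proof.
exists (Rees (rees_const_proof v iotaR a)) => // m /=.
by rewrite coefC; case: m => [|m]; [apply: cone_coef_const|apply: cone_coef0].
Qed.

Lemma cone_gr_mmap N r (g : 'I_r -> graded_ring v R) (P : {mpoly k[r]}) :
  (forall i, cone_gr N (g i)) -> cone_gr N (mmap (graded_const v iotaR) g P).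
Proof.
move=> hg; have h0 : cone_gr N 0.
  by rewrite -(rmorph0 (graded_const v iotaR)); apply: cone_gr_const.
have h1 : cone_gr N 1.
  by rewrite -(rmorph1 (graded_const v iotaR)); apply: cone_gr_const.
rewrite /mmap; elim/big_rec: _ => // m a _ ha; apply: cone_grD ha.
apply: cone_grM; first exact: cone_gr_const.
rewrite /mmap1; elim/big_rec: _ => // i b _ hb; apply: cone_grM hb.
elim: (m i) => [|j IH]; first by rewrite expr0.
by rewrite exprS; apply: cone_grM.
Qed.

(** Only finitely many coefficients are nonzero, and by monotonicity the largest of their indices
    [N] serves for all. *)
Lemma cone_rees_exhaustive (p : rees v R) : exists N, cone_rees N p.
Proof.
have hN m : exists N, cone_coef N m (val p)`_m.
  have /rees_predP/(_ m) := valP p; rewrite value_idealE => /andP[/R_frac[f [g [g0 ->]]]].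
  move=> /(vgeP _ _ g0) fm; have [N hN] := cone_exhaustive fm.
  by exists N, f, g, (phi f)`_m.
have /choice[N NP] := hN.
exists (\max_(m < size (val p)) N m)%N => m.
have [mp|pm] := ltnP m (size (val p)); last by rewrite nth_default //; apply: cone_coef0.
have [f [g [c [g0 zE fc cc]]]] := NP m; exists f, g, c; split=> //.
by apply: cone_mono cc; apply: (leq_bigmax (Ordinal mp)).
Qed.

Lemma cone_gr_mono N N' a : (N <= N')%N -> cone_gr N a -> cone_gr N' a.
Proof.
move=> NN [p hp ->]; exists p => // m.
have [f [g [c [g0 zE fc cc]]]] := hp m; exists f, g, c; split=> //.
exact: cone_mono cc.
Qed.

(** The witness is the class of [F f] in degree [m]. A representative in the cone with denominator
    [g] would put [c] times the constant term of [g] into the cone, which explains the scalar in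
    [cone_proper]. *)
Lemma not_cone_gr N : exists a, ~ cone_gr N a.
Proof.
have [m [f [c [fc proper]]]] := cone_proper N.
have Ff : F f \in value_ideal v R m.
  have g0 : (1 : {mpoly k[n]}).@[fun=> 0] != 0 by rewrite meval1 oner_eq0.
  have -> : F f = F f / F 1 by rewrite rmorph1 divr1.
  rewrite value_idealE; apply/andP; split; first by apply/R_frac; exists f, 1.
  by apply/(vgeP _ _ g0); have [? ->] := fc.
have FfX : (F f)%:P * 'X^m \in rees_pred v R.
  apply/rees_predP => i; rewrite coefCM coefXn.
  by have [->|_] := eqVneq i m; rewrite ?mulr1 ?mulr0 ?rpred0.
exists (gr (Rees FfX)) => -[p hp /graded_ring_eqP/(_ m)] /=.
rewrite coefCM coefXn eqxx mulr1 value_ideal_plusE => /andP[_].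
have [f' [g [c' [g0 -> fc' cc']]]] := hp m.
have -> : F f - F f' / F g = F (f * g - f') / F g.
  by rewrite rmorphB rmorphM mulrBl mulfK ?F_denom_neq0.
move=> /(vgtP _ _ g0) E; apply: (proper _ g0).
have fg : initial m (phi (f * g - f')) (c * (g.@[fun=> 0])%:MP - c').
  rewrite rmorphB rmorphM; apply: initialD (initialN fc').
  by rewrite -[m]addn0; apply: initialM (initial_denom _).
by have /eqP := initial_inj fg E; rewrite subr_eq0 => /eqP->.
Qed.

(** Finitely many generators lie in a single [cone_gr N], which is a proper subalgebra. *)
Lemma graded_ring_not_fg : ~ finitely_generated_algebra (graded_const v iotaR).
Proof.
move=> [r [g gP]].
have hN i : exists N, cone_gr N (g i).
  by have [N hN] := cone_rees_exhaustive (repr (g i)); exists N, (repr (g i)); rewrite ?reprK.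
have /choice[N NP] := hN.
have [a na] := not_cone_gr (\max_i N i)%N; apply: na; have [P ->] := gP a.
apply: cone_gr_mmap => i; apply: cone_gr_mono (NP i); exact: leq_bigmax.
Qed.

End GradedRing.

(** * The filtration by slopes along the cubic *)

Section CuspidalCone.

Variable k : fieldType.
Hypothesis k_char0 : [pchar k] =i pred0.

Local Notation S := {mpoly k[3]}.
Local Notation x := ('X_(o 3 0) : S).
Local Notation u := ('X_(o 3 2) : S).
Local Notation phi := (cuspidal_embedding k).

(** For a monomial x^d w^l free of u the deficit 4 d + l - m is at least d / (N + 1), that is, the
    contact m - d - l is at most (3 - 1 / (N + 1)) d. Monomials containing u vanish on the cubic and
    are left unconstrained. *)
Definition cuspidal_cone N m (c : S) := forall q : 'X_{1..3}, q \in msupp c ->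
  q (o 3 2) = 0%N -> (N.+1 * m + q (o 3 0) <= N.+1 * (4 * q (o 3 0) + q (o 3 1)))%N.

(** A deficit 0 with d > 0 is impossible: by [cuspidal_embedding_top] the coefficient just below
    order [m] would be d times a nonzero one, hence nonzero in characteristic 0. So the deficit is
    at least 1, which exceeds d / (N + 1) once N bounds d. *)
Lemma cuspidal_cone_exhaustive m f c :
  initial m (phi f) c -> exists N, cuspidal_cone N m c.
Proof.
move=> [fm fc]; exists (msize c) => q qc q2.
have qN : (q (o 3 0) < msize c)%N.
  apply: leq_ltn_trans (msize_mdeg_lt qc).
  by rewrite mdegE (bigD1 (o 3 0)) //= leq_addr.
have [top rel] := cuspidal_embedding_top f q2.
have cq : c@_q != 0 by rewrite -mcoeff_msupp.
have m_le : (m <= 4 * q (o 3 0) + q (o 3 1))%N.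
  by rewrite leqNgt; apply: contraNN cq => /top; rewrite fc => ->.
have [q0|q0] := posnP (q (o 3 0)).
  by move: m_le; rewrite q0 => m_le; move: (msize c) => N; nia.
have m_lt : (m < 4 * q (o 3 0) + q (o 3 1))%N.
  rewrite ltn_neqAle m_le andbT; apply: contraNneq cq => mE.
  move: (rel q0); rewrite -mE fc fm ?mcoeff0; last by rewrite ltn_predL; lia.
  move/esym/eqP; rewrite mulf_eq0 (iffLR (@pcharf0P _) k_char0) => /orP[/eqP q00|//].
  by rewrite q00 in q0.
move: (msize c) qN => N qN; nia.
Qed.

(** For d = 3 (N + 1) the form of [exists_near_top] has deficit 1 < d / (N + 1) = 3 at the monomial
    x^d, whose coefficient d is nonzero in characteristic 0. *)
Lemma cuspidal_cone_proper N : exists m f c,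
  initial m (phi f) c /\ forall a : k, a != 0 -> ~ cuspidal_cone N m (c * a%:MP).
Proof.
have [f [r]] := exists_near_top k N; set d := (3 * N.+1)%N => /= E.
pose c := x ^+ d * (d%:R + u * r`_0).
have fc : initial (4 * d).-1 (phi f) c.
  have coefE j : (phi f)`_j = ((x ^+ d)%:P * 'X^(4 * d) * ('X + d%:R%:P + u%:P * r))`_j.+1.
    by rewrite -E mulrC coefMX.
  have d0 : (0 < 4 * d)%N by rewrite /d.
  split=> [i id|]; rewrite coefE -mulrA coefCM coefXnM.
    by rewrite ifT ?mulr0 //; lia.
  by rewrite prednK // ltnn subnn !coefD coefX coefC coefCM add0r.
exists (4 * d).-1, f, c; split=> // a a0 hc.
pose q : 'X_{1..3} := (U_(o 3 0) *+ d)%MM.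
have q0 : q (o 3 0) = d by rewrite mulmnE mnm1E mul1n.
have q1 : q (o 3 1) = 0%N by rewrite mulmnE mnm1E.
have q2 : q (o 3 2) = 0%N by rewrite mulmnE mnm1E.
have /hc/(_ q2) : q \in msupp (c * a%:MP).
  rewrite mcoeff_msupp mulrC mcoeffCM mulf_neq0 // /c mulrDr mcoeffD mulrCA.
  rewrite mcoeff_mulX0 // addr0 mulrC -mpolyC_nat mcoeffCM mpolyXn mcoeffX eqxx mulr1.
  by rewrite (iffLR (@pcharf0P _) k_char0).
by rewrite q0 q1 /d; nia.
Qed.

Lemma cuspidal_valuation_not_fg :
  ~ finitely_generated_algebra (local_gr_const (cuspidal_valuation k)).
Proof.
have low (g : {mpoly k[4]}) : g.@[fun=> 0] != 0 -> g != 0 /\ lowdeg (phi g) = 0%N.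
  move=> g0; split; first by apply: contraNneq g0 => ->; rewrite meval0.
  exact: (lowdeg_denominator (@cuspidal_embedding0 k)).
apply: (@graded_ring_not_fg _ _ _ _ _ _ 4 3 (ratfun_of_poly k 4) phi
  _ _ _ _ _ _ _ cuspidal_cone).
- by [].
- by move=> f g /eqP; rewrite tofrac_eq => /eqP.
- exact: cuspidal_embeddingC.
- exact: cuspidal_embedding0.
- by move=> z; split=> [/asboolP|h] //; apply/asboolP.
- move=> m f g g0; have [gn0 g1] := low g g0.
  by have := vge_pullback (cuspidal_embedding_inj (k:=k)) (@cuspidal_embeddingC k)
    (cuspidal_embedding_unif k) m f gn0; rewrite g1 addn0.
- move=> m f g g0; have [gn0 g1] := low g g0.
  by have := vgt_pullback (cuspidal_embedding_inj (k:=k)) (@cuspidal_embeddingC k)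
    (cuspidal_embedding_unif k) m f gn0; rewrite g1 addn0.
- by move=> N m q; rewrite msupp0.
- move=> N m c d hc hd q /msuppD_le; rewrite mem_cat => /orP[]; [exact: hc|exact: hd].
- move=> N m m' c d hc hd q /msuppM_le/allpairsP[[q1 q2] /= [q1c q2d ->]].
  (* A product free of u has both factors free of u, and the slope inequality is additive. *)
  rewrite !mnmDE => q0; have := hc q1 q1c; have := hd q2 q2d; nia.
- move=> N a q; rewrite msuppC; case: eqP => // _; rewrite inE => /eqP-> _.
  by rewrite mnm0E muln0.
- move=> N N' m c NN hc q qc q0; have h := hc q qc q0.
  have : (m <= 4 * q (o 3 0) + q (o 3 1))%N by nia.
  nia.
- exact: cuspidal_cone_exhaustive.
exact: cuspidal_cone_proper.
Qed.

End CuspidalCone.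

Theorem mainTheorem2 (R : realType) :
  exists v : valuation (ratfun_const R[i] 4),
    [/\ divisorial v,
        centered_at_origin v
      & ~ finitely_generated_algebra (local_gr_const v)].
Proof.
exists (cuspidal_valuation R[i]); split.
- exact: cuspidal_valuation_divisorial.
- exact: cuspidal_valuation_centered.
exact/cuspidal_valuation_not_fg/pchar_num.
Qed.
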